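(* Let $a,b\in\mathbb C$ with $|a|\ge|b|>1$ and let $H_{a,b}=(\mathbb C^2\setminus\{0\})/\sim$, where $(z,w)\sim(az,bw)$. Then on $H_{a,b}$ there exists a Gauduchon metric with semi-positive holomorphic bisectional curvature.
   Context: A Hermitian metric $\omega$ on a complex surface is Gauduchon if $\partial\bar\partial\omega=0$. The Chern curvature of $\omega$ has components $R_{i\bar j k\bar \ell}=-\frac{\partial^2 g_{k\bar \ell}}{\partial z^i\partial\bar z^j}+g^{p\bar q}\frac{\partial g_{k\bar q}}{\partial z^i}\frac{\partial g_{p\bar \ell}}{\partial\bar z^j}$, and $\omega$ has semi-positive holomorphic bisectional curvature if $R_{i\bar j k\bar \ell}\xi^i\bar\xi^j\eta^k\bar\eta^\ell\ge0$ for all nonzero $\xi,\eta$ at every point. *)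

(* Defs.v *)
From Stdlib Require Import Reals Lra Lia ZArith Relations Cantor.
From Stdlib Require Import Classical ClassicalEpsilon FunctionalExtensionality
  PropExtensionality ProofIrrelevance.
From Coquelicot Require Import Coquelicot.

Set Implicit Arguments.
Unset Strict Implicit.
Unset Printing Implicit Defensive.

Open Scope R_scope.

(** C^2 is the product [C * C] with Coquelicot's product topology and product
    structure of normed module (over the absolute ring of complex numbers when
    holomorphy is concerned). *)

Definition C2 : Type := (C * C)%type.

Definition zero2 : C2 := (RtoC 0, RtoC 0).

Inductive idx : Set := i1 | i2.

Definition co (i : idx) (x : C2) : C :=
  match i with i1 => fst x | i2 => snd x end.

Definition basis (i : idx) : C2 :=
  match i with i1 => (RtoC 1, RtoC 0) | i2 => (RtoC 0, RtoC 1) end.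

Definition sum2 (f : idx -> C) : C := (f i1 + f i2)%C.

Definition line (x v : C2) (t : R) : C2 :=
  ((fst x + t * fst v)%C, (snd x + t * snd v)%C).

Definition ex_dir (v : C2) (f : C2 -> C) (x : C2) : Prop :=
  ex_derive (fun t => Re (f (line x v t))) 0 /\
  ex_derive (fun t => Im (f (line x v t))) 0.

Definition dir (v : C2) (f : C2 -> C) (x : C2) : C :=
  (Derive (fun t => Re (f (line x v t))) 0,
   Derive (fun t => Im (f (line x v t))) 0).

(** With z^i = x^i + sqrt(-1) y^i, [dir (basis i)] is d/dx^i and
    [dir (ibasis i)] is d/dy^i. *)
Definition ibasis (i : idx) : C2 :=
  ((Ci * fst (basis i))%C, (Ci * snd (basis i))%C).

(** The Wirtinger derivatives d/dz^i and d/d(conj z^i). *)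
Definition dz (i : idx) (f : C2 -> C) (x : C2) : C :=
  ((dir (basis i) f x - Ci * dir (ibasis i) f x) / 2)%C.

Definition dzb (i : idx) (f : C2 -> C) (x : C2) : C :=
  ((dir (basis i) f x + Ci * dir (ibasis i) f x) / 2)%C.

(** [Ck n D f]: on the open set [D], all partial derivatives of [f] of order at
    most [n] with respect to the four real coordinates exist and are
    continuous. *)
Fixpoint Ck (n : nat) (D : C2 -> Prop) (f : C2 -> C) : Prop :=
  (forall x, D x -> continuous f x) /\
  match n with
  | O => True
  | S m => forall i,
      (forall x, D x -> ex_dir (basis i) f x /\ ex_dir (ibasis i) f x) /\
      Ck m D (dir (basis i) f) /\ Ck m D (dir (ibasis i) f)
  end.

Definition smooth_on (D : C2 -> Prop) (f : C2 -> C) : Prop :=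
  forall n, Ck n D f.

(** A chart on [T] is a coordinate map, meaningful on [ch_dom], together with
    its inverse, meaningful on [ch_image]; both are totalised by arbitrary
    values. *)
Record chart (T : Type) := Chart {
  ch_dom : T -> Prop;
  ch_coord : T -> C2;
  ch_param : C2 -> T
}.

Definition ch_image (T : Type) (c : chart T) (x : C2) : Prop :=
  exists p, ch_dom c p /\ ch_coord c p = x.

Definition transition (T : Type) (c d : chart T) (x : C2) : C2 :=
  ch_coord d (ch_param c x).

Record complex_surface := ComplexSurface {
  cs_pt :> Type;
  cs_open : (cs_pt -> Prop) -> Prop;
  cs_open_full : cs_open (fun _ => True);
  cs_open_inter : forall U V, cs_open U -> cs_open V ->
    cs_open (fun p => U p /\ V p);
  cs_open_union : forall F : (cs_pt -> Prop) -> Prop,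
    (forall U, F U -> cs_open U) -> cs_open (fun p => exists U, F U /\ U p);
  cs_hausdorff : forall p q, p <> q -> exists U V,
    cs_open U /\ cs_open V /\ U p /\ V q /\ (forall r, U r -> V r -> False);
  cs_second_countable : exists B : nat -> cs_pt -> Prop,
    (forall n, cs_open (B n)) /\
    (forall U p, cs_open U -> U p ->
      exists n, B n p /\ (forall q, B n q -> U q));
  cs_atlas : chart cs_pt -> Prop;
  cs_cover : forall p, exists c, cs_atlas c /\ ch_dom c p;
  cs_dom_open : forall c, cs_atlas c -> cs_open (ch_dom c);
  cs_image_open : forall c, cs_atlas c -> open (ch_image c);
  cs_param_coord : forall c p, cs_atlas c -> ch_dom c p ->
    ch_param c (ch_coord c p) = p;
  cs_chart_homeo : forall c (U : cs_pt -> Prop), cs_atlas c ->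
    (forall p, U p -> ch_dom c p) ->
    (cs_open U <-> open (fun x : C2 => exists p, U p /\ ch_coord c p = x));
  cs_holomorphic : forall c d p, cs_atlas c -> cs_atlas d ->
    ch_dom c p -> ch_dom d p ->
    ex_filterdiff (K := C_AbsRing)
      (transition c d : C * C -> C * C) (locally (ch_coord c p))
}.

(** In each chart, the metric is given by the functions g_{k lbar}, on the image
    of the chart; the last field says that they are the components of one tensor
    sum g_{k lbar} dz^k (x) d(zbar)^l on the surface. *)
Record hermitian_metric (X : complex_surface) := HermitianMetric {
  hm_comp :> chart X -> idx -> idx -> C2 -> C;
  hm_smooth : forall c k l, cs_atlas c ->
    smooth_on (ch_image c) (hm_comp c k l);
  hm_hermitian : forall c k l x, cs_atlas c -> ch_image c x ->
    hm_comp c l k x = Cconj (hm_comp c k l x);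
  hm_pos : forall c x (v : C2), cs_atlas c -> ch_image c x -> v <> zero2 ->
    0 < Re (sum2 (fun k => sum2 (fun l =>
              (hm_comp c k l x * co k v * Cconj (co l v))%C)));
  hm_tensor : forall c d p k l, cs_atlas c -> cs_atlas d ->
    ch_dom c p -> ch_dom d p ->
    let x := ch_coord c p in
    let J m n := dz n (fun y => co m (transition c d y)) x in
    hm_comp c k l x =
      sum2 (fun m => sum2 (fun n =>
        (J m k * Cconj (J n l) * hm_comp d m n (transition c d x))%C))
}.

(** For a (1,1)-form sum w_{k lbar} dz^k /\ d(zbar)^l, its image under dbar is,
    up to sign, the (1,2)-form with components [dbar11 w k j l] on
    dz^k /\ d(zbar)^j /\ d(zbar)^l (j < l).  For a (1,2)-form with components
    [u k j l], its image under del has components [del12 u i k j l] on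
    dz^i /\ dz^k /\ d(zbar)^j /\ d(zbar)^l (i < k, j < l). *)
Definition dbar11 (w : idx -> idx -> C2 -> C) (k j l : idx) (x : C2) : C :=
  (dzb j (w k l) x - dzb l (w k j) x)%C.

Definition del12 (u : idx -> idx -> idx -> C2 -> C) (i k j l : idx) (x : C2)
  : C :=
  (dz i (u k j l) x - dz k (u i j l) x)%C.

(** Components of sqrt(-1) sum g_{k lbar} dz^k /\ d(zbar)^l. *)
Definition fundamental_form (X : complex_surface) (g : hermitian_metric X)
    (c : chart X) (k l : idx) (x : C2) : C :=
  (Ci * g c k l x)%C.

Definition gauduchon (X : complex_surface) (g : hermitian_metric X) : Prop :=
  forall (c : chart X) (x : C2), cs_atlas c -> ch_image c x ->
  forall i k j l,
    del12 (dbar11 (fundamental_form g c)) i k j l x = RtoC 0.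

Definition mdet (g : idx -> idx -> C2 -> C) (x : C2) : C :=
  (g i1 i1 x * g i2 i2 x - g i1 i2 x * g i2 i1 x)%C.

(** g^{p qbar}, i.e. the entry (q, p) of the inverse of the matrix
    (g_{k lbar}); see [ginvP]. *)
Definition ginv (g : idx -> idx -> C2 -> C) (p q : idx) (x : C2) : C :=
  match p, q with
  | i1, i1 => (g i2 i2 x / mdet g x)%C
  | i1, i2 => (- g i2 i1 x / mdet g x)%C
  | i2, i1 => (- g i1 i2 x / mdet g x)%C
  | i2, i2 => (g i1 i1 x / mdet g x)%C
  end.

Lemma ginvP (g : idx -> idx -> C2 -> C) (x : C2) (p k : idx) :
  mdet g x <> RtoC 0 ->
  sum2 (fun q => (ginv g p q x * g k q x)%C) =
    match p, k with i1, i1 | i2, i2 => RtoC 1 | _, _ => RtoC 0 end.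
Proof.
intros H; unfold sum2, ginv, mdet in *; destruct p, k; now field.
Qed.

Definition chern_curvature (g : idx -> idx -> C2 -> C) (i j k l : idx) (x : C2)
  : C :=
  (- dz i (dzb j (g k l)) x +
   sum2 (fun p => sum2 (fun q =>
     ginv g p q x * dz i (g k q) x * dzb j (g p l) x)))%C.

Definition bisectional (g : idx -> idx -> C2 -> C) (x xi eta : C2) : C :=
  sum2 (fun i => sum2 (fun j => sum2 (fun k => sum2 (fun l =>
    (chern_curvature g i j k l x *
     co i xi * Cconj (co j xi) * co k eta * Cconj (co l eta))%C)))).

Definition semipositive_bisectional (X : complex_surface)
    (g : hermitian_metric X) : Prop :=
  forall (c : chart X) (x xi eta : C2), cs_atlas c -> ch_image c x ->
    xi <> zero2 -> eta <> zero2 ->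
    Im (bisectional (g c) x xi eta) = 0 /\
    0 <= Re (bisectional (g c) x xi eta).

Definition hopf_step (a b : C) (x y : C2) : Prop :=
  y = ((a * fst x)%C, (b * snd x)%C).

Definition hopf_rel (a b : C) : C2 -> C2 -> Prop :=
  clos_refl_sym_trans C2 (hopf_step a b).

(** Points are the equivalence classes of nonzero vectors. *)
Definition hopf_pt (a b : C) : Type :=
  {P : C2 -> Prop | exists x, x <> zero2 /\ P = hopf_rel a b x}.

Definition in_class (a b : C) (p : hopf_pt a b) (x : C2) : Prop :=
  proj1_sig p x.

(** The quotient topology: since [C2] minus the origin is open, preimages can be
    tested for openness in [C2]. *)
Definition hopf_open (a b : C) (U : hopf_pt a b -> Prop) : Prop :=
  open (fun x : C2 => exists p, U p /\ in_class p x).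

(** The charts are the sections of the projection (from [C2] minus the origin)
    with open image, i.e. its local inverses. *)
Definition hopf_atlas (a b : C) (c : chart (hopf_pt a b)) : Prop :=
  open (ch_image c) /\
  forall p, ch_dom c p ->
    in_class p (ch_coord c p) /\ ch_param c (ch_coord c p) = p.

Section HopfSurface.

Variables a b : C.
Hypothesis Ha : 1 < Cmod a.
Hypothesis Hb : 1 < Cmod b.

Let a0 : a <> RtoC 0.
Proof. intros E; rewrite E, Cmod_0 in Ha; lra. Qed.

Let b0 : b <> RtoC 0.
Proof. intros E; rewrite E, Cmod_0 in Hb; lra. Qed.

Definition Cpowz (c : C) (k : Z) : C :=
  (c ^ Z.to_nat k / c ^ Z.to_nat (- k))%C.

Lemma Cpowz_succ c k : c <> RtoC 0 -> Cpowz c (Z.succ k) = (c * Cpowz c k)%C.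
Proof.
intros c0; unfold Cpowz.
destruct (Z_lt_le_dec k 0) as [H|H].
- replace (Z.to_nat k) with O by lia.
  replace (Z.to_nat (Z.succ k)) with O by lia.
  replace (Z.to_nat (- k)) with (S (Z.to_nat (- Z.succ k))) by lia.
  simpl; field; split; [apply Cpow_nz|]; assumption.
- replace (Z.to_nat (- k)) with O by lia.
  replace (Z.to_nat (- Z.succ k)) with O by lia.
  replace (Z.to_nat (Z.succ k)) with (S (Z.to_nat k)) by lia.
  simpl; field.
Qed.

Lemma Cpowz_0 c : Cpowz c 0 = RtoC 1.
Proof. unfold Cpowz; simpl; field. Qed.

Lemma Cpowz_add c j k :
  c <> RtoC 0 -> Cpowz c (j + k) = (Cpowz c j * Cpowz c k)%C.
Proof.
intros c0; revert j; apply Z.peano_ind.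
- now rewrite Z.add_0_l, Cpowz_0, Cmult_1_l.
- intros j IH; rewrite Z.add_succ_l, !Cpowz_succ, IH by assumption; ring.
- intros j IH.
  rewrite <- (Z.succ_pred j), Z.add_succ_l, !Cpowz_succ in IH by assumption.
  rewrite Z.add_comm, <- (Z.add_comm (Z.pred j)).
  apply (f_equal (fun z => (/ c * z)%C)) in IH.
  rewrite !Cmult_assoc, Cinv_l, !Cmult_1_l in IH by assumption; exact IH.
Qed.

Lemma Cmod_Cpowz c k :
  1 < Cmod c -> Cmod (Cpowz c k) = Rpower (Cmod c) (IZR k).
Proof.
intros Hc.
assert (c0 : c <> RtoC 0) by (intros E; rewrite E, Cmod_0 in Hc; lra).
revert k; apply Z.peano_ind.
- rewrite Cpowz_0, Cmod_1, Rpower_O; lra.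
- intros k IH; rewrite Cpowz_succ, Cmod_mult, IH, succ_IZR, Rpower_plus,
    Rpower_1 by (assumption || lra); ring.
- intros k IH; rewrite <- (Z.succ_pred k) in IH.
  rewrite Cpowz_succ, Cmod_mult, succ_IZR, Rpower_plus, Rpower_1 in IH
    by (assumption || lra).
  apply Rmult_eq_reg_l with (Cmod c); [rewrite IH; ring | lra].
Qed.

Definition act (k : Z) (x : C2) : C2 :=
  ((Cpowz a k * fst x)%C, (Cpowz b k * snd x)%C).

Lemma act_0 x : act 0 x = x.
Proof. unfold act; rewrite !Cpowz_0, !Cmult_1_l; now destruct x. Qed.

Lemma act_add j k x : act (j + k) x = act j (act k x).
Proof. unfold act; simpl; rewrite !Cpowz_add by assumption; f_equal; ring. Qed.

Lemma act_1 x : act 1 x = ((a * fst x)%C, (b * snd x)%C).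
Proof.
unfold act; change 1%Z with (Z.succ 0).
now rewrite !Cpowz_succ, !Cpowz_0, !Cmult_1_r by assumption.
Qed.

Lemma act_opp k x y : y = act k x -> x = act (- k) y.
Proof. intros ->; now rewrite <- act_add, Z.add_opp_diag_l, act_0. Qed.

Lemma hopf_relP x y : hopf_rel a b x y <-> exists k, y = act k x.
Proof.
split.
- intros H; induction H as [x y H | x | x y _ [k IH] | x y z _ [k IH] _ [j IH']].
  + exists 1%Z; now rewrite act_1.
  + exists 0%Z; now rewrite act_0.
  + exists (- k)%Z; now apply act_opp.
  + exists (j + k)%Z; now rewrite act_add, <- IH.
- intros [k ->]; revert k; apply Z.peano_ind.
  + rewrite act_0; apply rst_refl.
  + intros k IH; apply rst_trans with (1 := IH), rst_step.
    unfold hopf_step; now rewrite <- act_1, <- act_add, Z.add_1_l.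
  + intros k IH; apply rst_trans with (1 := IH), rst_sym, rst_step.
    unfold hopf_step.
    now rewrite <- act_1, <- act_add, Z.add_1_l, Z.succ_pred.
Qed.

Lemma act_zero2 k : act k zero2 = zero2.
Proof. unfold act, zero2; simpl; now rewrite !Cmult_0_r. Qed.

Lemma act_linear k : is_linear (K := C_AbsRing) (act k : C * C -> C * C).
Proof.
apply (is_linear_prod (K := C_AbsRing)
  (T := prod_NormedModule C_AbsRing C_NormedModule C_NormedModule)
  (U := C_NormedModule) (V := C_NormedModule)).
- apply (is_linear_comp (K := C_AbsRing)
    (U := prod_NormedModule C_AbsRing C_NormedModule C_NormedModule)
    (V := C_NormedModule) (W := C_NormedModule) fst
    (fun z : C => (Cpowz a k * z)%C)).
  + apply is_linear_fst.
  + apply (@is_linear_scal_r C_AbsRing C_NormedModule (Cpowz a k)).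
    intros; apply Cmult_comm.
- apply (is_linear_comp (K := C_AbsRing)
    (U := prod_NormedModule C_AbsRing C_NormedModule C_NormedModule)
    (V := C_NormedModule) (W := C_NormedModule) snd
    (fun z : C => (Cpowz b k * z)%C)).
  + apply is_linear_snd.
  + apply (@is_linear_scal_r C_AbsRing C_NormedModule (Cpowz b k)).
    intros; apply Cmult_comm.
Qed.

Lemma act_continuous k (x : C2) : continuous (act k : C * C -> C * C) x.
Proof.
apply (linear_cont (K := C_AbsRing)
  (U := prod_NormedModule C_AbsRing C_NormedModule C_NormedModule)
  (V := prod_NormedModule C_AbsRing C_NormedModule C_NormedModule)).
apply act_linear.
Qed.

Lemma open_act k (V : C2 -> Prop) :
  open (V : C * C -> Prop) -> open (fun x : C * C => V (act k x)).
Proof.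
intros HV; apply (open_comp (act k : C * C -> C * C)); [|exact HV].
intros x _; apply act_continuous.
Qed.

Lemma open_sat (V : C2 -> Prop) :
  open (V : C * C -> Prop) -> open (fun x : C * C => exists k, V (act k x)).
Proof.
intros HV x [k Hk].
generalize (@open_act k V HV x Hk); apply filter_imp; intros y Hy; now exists k.
Qed.

Definition class_of (x : C2) (Hx : x <> zero2) : hopf_pt a b :=
  exist _ (hopf_rel a b x) (ex_intro _ x (conj Hx eq_refl)).

Lemma class_of_in x (Hx : x <> zero2) : in_class (class_of Hx) x.
Proof. apply rst_refl. Qed.

Lemma in_class_nonzero (p : hopf_pt a b) x : in_class p x -> x <> zero2.
Proof.
destruct p as [P [y [Hy ->]]]; unfold in_class; simpl.
intros H; apply hopf_relP in H; destruct H as [k ->]; intros E.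
symmetry in E; apply act_opp in E; rewrite act_zero2 in E; contradiction.
Qed.

Lemma in_class_ex (p : hopf_pt a b) : exists x, in_class p x.
Proof. destruct p as [P [x [Hx ->]]]; exists x; apply rst_refl. Qed.

Lemma in_class_act (p : hopf_pt a b) x y :
  in_class p x -> in_class p y <-> exists k, y = act k x.
Proof.
destruct p as [P [z [Hz ->]]]; unfold in_class; simpl; intros H.
rewrite <- hopf_relP; split; intros H'.
- eapply rst_trans; [apply rst_sym; exact H | exact H'].
- eapply rst_trans; eassumption.
Qed.

Lemma in_class_inj (p q : hopf_pt a b) x :
  in_class p x -> in_class q x -> p = q.
Proof.
intros Hp Hq.
assert (E : proj1_sig p = proj1_sig q).
{ apply functional_extensionality; intros y; apply propositional_extensionality.
  change (in_class p y <-> in_class q y).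
  now rewrite (in_class_act y Hp), (in_class_act y Hq). }
destruct p as [P HP], q as [Q HQ]; simpl in E; subst Q.
f_equal; apply proof_irrelevance.
Qed.

(** [annulus r] meets [act k (annulus s)] for at most one
    [k], and these sets cover C^2 minus the origin. *)
Definition annulus (r : R) (x : C2) : Prop :=
  (Cmod (fst x) < Rpower (Cmod a) (r + / 2) /\
   Cmod (snd x) < Rpower (Cmod b) (r + / 2)) /\
  (Rpower (Cmod a) r < Cmod (fst x) \/ Rpower (Cmod b) r < Cmod (snd x)).

Lemma annulus_act r x k : annulus r x -> annulus (r + IZR k) (act k x).
Proof.
assert (M : forall c u v s, 1 < Cmod c ->
  (Cmod u < Rpower (Cmod c) s -> v = (Cpowz c k * u)%C ->
     Cmod v < Rpower (Cmod c) (s + IZR k)) /\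
  (Rpower (Cmod c) s < Cmod u -> v = (Cpowz c k * u)%C ->
     Rpower (Cmod c) (s + IZR k) < Cmod v)).
{ intros c u v s Hc; split; intros H ->;
  rewrite Cmod_mult, Cmod_Cpowz, Rpower_plus, Rmult_comm by assumption;
  (apply Rmult_lt_compat_r || apply Rmult_lt_compat_l);
  try assumption; try apply exp_pos.
  all: rewrite Rmult_comm; now apply Rmult_lt_compat_l; [apply exp_pos|]. }
unfold annulus; simpl.
replace (r + IZR k + / 2) with (r + / 2 + IZR k) by ring.
intros [[H1 H2] H3]; repeat split.
- now apply (M a (fst x) _ (r + / 2)).
- now apply (M b (snd x) _ (r + / 2)).
- destruct H3 as [H3|H3]; [left | right].
  + now apply (M a (fst x) _ r).
  + now apply (M b (snd x) _ r).
Qed.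

Lemma annulus_close r s x : annulus r x -> annulus s x -> Rabs (r - s) < / 2.
Proof.
assert (M : forall c t t', 1 < c -> Rpower c t < Rpower c t' -> t < t').
{ intros c t t' Hc H; apply Rnot_le_lt; intros H'.
  apply Rle_Rpower with (e := c) in H'; lra. }
assert (K : forall r s, annulus r x -> annulus s x -> r - s < / 2).
{ intros r' s' [_ H] [[H1 H2] _]; destruct H as [H|H].
  - assert (H' := Rlt_trans _ _ _ H H1); apply M in H'; lra.
  - assert (H' := Rlt_trans _ _ _ H H2); apply M in H'; lra. }
intros H H'; apply Rabs_def1; [now apply K|].
assert (s - r < / 2) by now apply K. lra.
Qed.

Lemma annulus_unique r s x y j k :
  annulus r x -> annulus s (act j x) -> annulus r y -> annulus s (act k y) ->
  j = k.
Proof.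
intros H1 H2 H3 H4.
assert (H5 := annulus_close (annulus_act j H1) H2).
assert (H6 := annulus_close (annulus_act k H3) H4).
apply Rabs_def2 in H5; apply Rabs_def2 in H6.
assert (A : (j < k + 1)%Z) by (apply lt_IZR; rewrite plus_IZR; lra).
assert (B : (k < j + 1)%Z) by (apply lt_IZR; rewrite plus_IZR; lra).
lia.
Qed.

Lemma annulus_nonzero r x : annulus r x -> x <> zero2.
Proof.
intros [_ H] ->; simpl in H; rewrite Cmod_0 in H.
destruct H as [H|H]; revert H; apply Rle_not_lt, Rlt_le, exp_pos.
Qed.

Lemma annulus_ex x : x <> zero2 -> exists r, annulus r x.
Proof.
intros Hx; destruct x as [z w]; unfold annulus; simpl.
assert (P : forall c u, 1 < Cmod c -> u <> RtoC 0 ->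
  exists t, Cmod u = Rpower (Cmod c) t).
{ intros c u Hc Hu; exists (ln (Cmod u) / ln (Cmod c)); unfold Rpower.
  assert (0 < ln (Cmod c)) by (rewrite <- ln_1; apply ln_increasing; lra).
  replace (ln (Cmod u) / ln (Cmod c) * ln (Cmod c)) with (ln (Cmod u))
    by (field; lra).
  symmetry; apply exp_ln; now apply Cmod_gt_0. }
destruct (classic (z = RtoC 0)) as [Ez|Ez].
- destruct (classic (w = RtoC 0)) as [Ew|Ew].
  { exfalso; apply Hx; unfold zero2; now rewrite Ez, Ew. }
  destruct (P b w Hb Ew) as [t Ht]; exists (t - / 4).
  rewrite Ez, Cmod_0, Ht; repeat split.
  + apply exp_pos.
  + apply Rpower_lt; lra.
  + right; apply Rpower_lt; lra.
- destruct (P a z Ha Ez) as [s Hs].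
  destruct (classic (w = RtoC 0)) as [Ew|Ew].
  + exists (s - / 4); rewrite Ew, Cmod_0, Hs; repeat split.
    * apply Rpower_lt; lra.
    * apply exp_pos.
    * left; apply Rpower_lt; lra.
  + destruct (P b w Hb Ew) as [t Ht].
    assert (M1 := Rmax_l s t); assert (M2 := Rmax_r s t).
    exists (Rmax s t - / 4); rewrite Hs, Ht; repeat split.
    * apply Rpower_lt; lra.
    * apply Rpower_lt; lra.
    * destruct (Rle_dec s t) as [H|H].
      -- right; rewrite Rmax_right by lra; apply Rpower_lt; lra.
      -- left; rewrite Rmax_left by lra; apply Rpower_lt; lra.
Qed.

Lemma Cmod_continuous (z : C) : continuous Cmod z.
Proof. exact (@filterlim_norm C_AbsRing C_NormedModule z). Qed.

Lemma open_pre (f : C * C -> R) (D : R -> Prop) :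
  (forall z, continuous f z) -> open D -> open (fun z => D (f z)).
Proof. intros Hf HD; apply (open_comp f D); [intros z _; apply Hf | exact HD]. Qed.

Lemma annulus_open r : open (annulus r : C * C -> Prop).
Proof.
assert (F : forall x : C * C, continuous (fun x : C * C => Cmod (fst x)) x)
  by (intros x; apply (continuous_comp fst Cmod);
      [apply continuous_fst | apply Cmod_continuous]).
assert (G : forall x : C * C, continuous (fun x : C * C => Cmod (snd x)) x)
  by (intros x; apply (continuous_comp snd Cmod);
      [apply continuous_snd | apply Cmod_continuous]).
unfold annulus; apply open_and; [apply open_and | apply open_or].
- apply (open_pre (f := fun x => Cmod (fst x))
    (D := (fun t => t < Rpower (Cmod a) (r + / 2)))); [auto | apply open_lt].
- apply (open_pre (f := fun x => Cmod (snd x))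
    (D := (fun t => t < Rpower (Cmod b) (r + / 2)))); [auto | apply open_lt].
- apply (open_pre (f := fun x => Cmod (fst x))
    (D := (fun t => Rpower (Cmod a) r < t))); [auto | apply open_gt].
- apply (open_pre (f := fun x => Cmod (snd x))
    (D := (fun t => Rpower (Cmod b) r < t))); [auto | apply open_gt].
Qed.

Lemma hopf_open_image (V : C2 -> Prop) : open (V : C * C -> Prop) ->
  hopf_open (fun p : hopf_pt a b => exists x, V x /\ in_class p x).
Proof.
intros HV.
assert (H : open (fun x : C * C => x <> zero2 /\ exists k, V (act k x))).
{ apply open_and; [|now apply open_sat].
  intros x Hx; destruct (annulus_ex Hx) as [r Hr].
  generalize (@annulus_open r x Hr); apply filter_imp; intros y.
  apply annulus_nonzero. }
unfold hopf_open; intros x [p [[y [Hy Hp]] Hx]].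
assert (H' : x <> zero2 /\ exists k, V (act k x)).
{ split; [exact (in_class_nonzero Hx)|].
  apply (proj1 (in_class_act y Hx)) in Hp; destruct Hp as [k E].
  exists k; now rewrite <- E. }
generalize (H x H'); apply filter_imp; intros u [Hu [k Hk]].
exists (class_of Hu); split; [|apply class_of_in].
exists (act k u); split; [exact Hk|].
apply (in_class_act _ (class_of_in Hu)); now exists k.
Qed.

Lemma hopf_open_full : hopf_open (fun _ : hopf_pt a b => True).
Proof.
unfold hopf_open; intros x [p [_ Hx]].
destruct (annulus_ex (in_class_nonzero Hx)) as [r Hr].
generalize (@annulus_open r x Hr); apply filter_imp; intros y Hy.
exists (class_of (annulus_nonzero Hy)); split; [exact I | apply class_of_in].
Qed.

Lemma hopf_open_inter (U V : hopf_pt a b -> Prop) :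
  hopf_open U -> hopf_open V -> hopf_open (fun p => U p /\ V p).
Proof.
intros HU HV x [p [[H1 H2] Hx]].
generalize (filter_and _ _ (HU x (ex_intro _ p (conj H1 Hx)))
                           (HV x (ex_intro _ p (conj H2 Hx)))).
apply filter_imp; intros y [[q [Hq Hy]] [q' [Hq' Hy']]].
exists q; repeat split; try assumption.
now rewrite (in_class_inj Hy Hy').
Qed.

Lemma hopf_open_union (F : (hopf_pt a b -> Prop) -> Prop) :
  (forall U, F U -> hopf_open U) -> hopf_open (fun p => exists U, F U /\ U p).
Proof.
intros HF x [p [[U [HU Hp]] Hx]].
generalize (HF U HU x (ex_intro _ p (conj Hp Hx))).
apply filter_imp; intros y [q [Hq Hy]]; exists q; split; [|exact Hy].
now exists U.
Qed.

Lemma C2_separated (x y : C2) : x <> y -> exists U V : C * C -> Prop,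
  open U /\ open V /\ U x /\ V y /\ (forall z, U z -> V z -> False).
Proof.
intros Hxy.
assert (H : exists f : C * C -> R, (forall z, continuous f z) /\ f x < f y).
{ assert (K : exists f : C * C -> R, (forall z, continuous f z) /\ f x <> f y).
  { apply NNPP; intros N; apply Hxy.
    assert (N' : forall f : C * C -> R, (forall z, continuous f z) -> f x = f y).
    { intros f Hf; apply NNPP; intros E; apply N; now exists f. }
    destruct x as [[x1 x2] [x3 x4]], y as [[y1 y2] [y3 y4]].
    assert (E1 := N' (fun z => fst (fst z))); assert (E2 := N' (fun z => snd (fst z))).
    assert (E3 := N' (fun z => fst (snd z))); assert (E4 := N' (fun z => snd (snd z))).
    simpl in *; rewrite E1, E2, E3, E4; [reflexivity|..]; intros z.
    - apply (continuous_comp (snd : C * C -> C) snd);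
        [apply continuous_snd | apply (continuous_snd (U := R_UniformSpace))].
    - apply (continuous_comp (snd : C * C -> C) fst);
        [apply continuous_snd | apply (continuous_fst (V := R_UniformSpace))].
    - apply (continuous_comp (fst : C * C -> C) snd);
        [apply continuous_fst | apply (continuous_snd (U := R_UniformSpace))].
    - apply (continuous_comp (fst : C * C -> C) fst);
        [apply continuous_fst | apply (continuous_fst (V := R_UniformSpace))]. }
  destruct K as [f [Hf Hn]]; destruct (Rtotal_order (f x) (f y)) as [H|[H|H]].
  - now exists f.
  - contradiction.
  - exists (fun z => - f z); split; [|lra].
    intros z; apply (continuous_opp (K := R_AbsRing) (V := R_NormedModule)).
    apply Hf. }
destruct H as [f [Hf H]].
exists (fun z => f z < (f x + f y) / 2), (fun z => (f x + f y) / 2 < f z).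
repeat split; try lra.
- apply (open_pre (D := fun t => t < (f x + f y) / 2)); [auto | apply open_lt].
- apply (open_pre (D := fun t => (f x + f y) / 2 < t)); [auto | apply open_gt].
- intros; lra.
Qed.

Lemma hopf_hausdorff (p q : hopf_pt a b) : p <> q -> exists U V,
  hopf_open U /\ hopf_open V /\ U p /\ V q /\ (forall r, U r -> V r -> False).
Proof.
intros Hpq.
destruct (in_class_ex p) as [x Hx], (in_class_ex q) as [y Hy].
destruct (annulus_ex (in_class_nonzero Hx)) as [r Hr].
destruct (annulus_ex (in_class_nonzero Hy)) as [s Hs].
assert (H : exists U V : C * C -> Prop, open U /\ open V /\ U x /\ V y /\
  forall u k, U u -> V (act k u) -> False).
{ destruct (classic (exists u k, annulus r u /\ annulus s (act k u)))
    as [[u [k [Hu Hk]]]|N].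
  - assert (Hne : act k x <> y).
    { intros E; apply Hpq, (in_class_inj (x := y)); [|exact Hy].
      apply (in_class_act _ Hx); now exists k. }
    destruct (C2_separated Hne) as [U [V [HU [HV [Ux [Vy D]]]]]].
    exists (fun z => annulus r z /\ U (act k z)), (fun z => annulus s z /\ V z).
    split; [apply open_and; [apply annulus_open | now apply open_act]|].
    split; [apply open_and; [apply annulus_open | exact HV]|].
    split; [now split|]; split; [now split|].
    intros v j [V1 V2] [V3 V4].
    assert (E := annulus_unique V1 V3 Hu Hk); subst j.
    exact (D _ V2 V4).
  - exists (annulus r), (annulus s).
    do 2 (split; [apply annulus_open|]); do 2 (split; [assumption|]).
    intros u k Hu Hk; apply N; now exists u, k. }
destruct H as [U [V [HU [HV [Ux [Vy D]]]]]].
exists (fun p => exists x, U x /\ in_class p x).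
exists (fun p => exists x, V x /\ in_class p x).
split; [now apply hopf_open_image|].
split; [now apply hopf_open_image|].
split; [now exists x|].
split; [now exists y|].
intros t [u [Hu Tu]] [v [Hv Tv]].
apply (proj1 (in_class_act v Tu)) in Tv; destruct Tv as [k ->].
exact (D _ _ Hu Hv).
Qed.

(** Grid points: the integers [p - q] divided by [N + 1]. *)
Definition grid (N m : nat) : R :=
  (INR (fst (of_nat m)) - INR (snd (of_nat m))) / (INR N + 1).

Lemma grid_dense N x : exists m, Rabs (x - grid N m) < / (INR N + 1).
Proof.
assert (HN : 0 < INR N + 1) by (generalize (pos_INR N); lra).
destruct (archimed (x * (INR N + 1) - 1 / 2)) as [A1 A2].
set (k := up (x * (INR N + 1) - 1 / 2)) in *.
exists (to_nat (Z.to_nat k, Z.to_nat (- k))).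
unfold grid; rewrite cancel_of_to; simpl.
replace (INR (Z.to_nat k) - INR (Z.to_nat (- k))) with (IZR k).
2: { rewrite !INR_IZR_INZ, <- minus_IZR; f_equal; lia. }
replace (x - IZR k / (INR N + 1))
  with ((x * (INR N + 1) - IZR k) * / (INR N + 1)) by (field; lra).
rewrite Rabs_mult, (Rabs_pos_eq (/ _))
  by (apply Rlt_le, Rinv_0_lt_compat; exact HN).
rewrite <- (Rmult_1_l (/ (INR N + 1))) at 2.
apply Rmult_lt_compat_r; [now apply Rinv_0_lt_compat|].
apply Rabs_def1; lra.
Qed.

Lemma hopf_second_countable : exists B : nat -> hopf_pt a b -> Prop,
  (forall n, hopf_open (B n)) /\
  (forall U p, hopf_open U -> U p ->
    exists n, B n p /\ (forall q, B n q -> U q)).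
Proof.
set (V := fun n : nat =>
  let (N, m) := of_nat n in let (u, v) := of_nat m in
  let (u1, u2) := of_nat u in let (v1, v2) := of_nat v in
  fun x : C * C =>
    (Rabs (fst (fst x) - grid N u1) < / (INR N + 1) /\
     Rabs (snd (fst x) - grid N u2) < / (INR N + 1)) /\
    (Rabs (fst (snd x) - grid N v1) < / (INR N + 1) /\
     Rabs (snd (snd x) - grid N v2) < / (INR N + 1))).
assert (HV : forall n, open (V n)).
{ assert (L : forall (f : C * C -> R) y e, (forall z, continuous f z) ->
    open (fun z : C * C => Rabs (f z - y) < e)).
  { intros f y e Hf.
    apply (open_pre (f := fun z => Rabs (f z - y)) (D := fun t => t < e));
      [|apply open_lt].
    intros z; apply (continuous_comp (fun z => f z - y) Rabs).
    - apply (continuous_minus (K := R_AbsRing) (V := R_NormedModule)).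
      + apply Hf.
      + apply continuous_const.
    - apply continuous_Rabs. }
  intros n; unfold V.
  destruct (of_nat n) as [N m], (of_nat m) as [u v].
  destruct (of_nat u) as [u1 u2], (of_nat v) as [v1 v2].
  apply open_and; apply open_and.
  - apply (L (fun z => fst (fst z))); intros z.
    apply (continuous_comp (fst : C * C -> C) fst);
      [apply continuous_fst | apply (continuous_fst (V := R_UniformSpace))].
  - apply (L (fun z => snd (fst z))); intros z.
    apply (continuous_comp (fst : C * C -> C) snd);
      [apply continuous_fst | apply (continuous_snd (U := R_UniformSpace))].
  - apply (L (fun z => fst (snd z))); intros z.
    apply (continuous_comp (snd : C * C -> C) fst);
      [apply continuous_snd | apply (continuous_fst (V := R_UniformSpace))].
  - apply (L (fun z => snd (snd z))); intros z.
    apply (continuous_comp (snd : C * C -> C) snd);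
      [apply continuous_snd | apply (continuous_snd (U := R_UniformSpace))]. }
exists (fun n p => exists x, V n x /\ in_class p x); split.
{ intros n; now apply hopf_open_image. }
intros U p HU Up; destruct (in_class_ex p) as [x Hx].
destruct (HU x (ex_intro _ p (conj Up Hx))) as [[e He] Hball].
destruct (nfloor_ex (2 / e)) as [N [_ HN]].
{ apply Rlt_le, Rdiv_lt_0_compat; lra. }
assert (HN0 : 0 < INR N + 1) by (generalize (pos_INR N); lra).
assert (He2 : 2 * / (INR N + 1) < e).
{ apply Rmult_lt_reg_r with (INR N + 1); [exact HN0|].
  rewrite Rmult_assoc, Rinv_l, Rmult_1_r by lra.
  apply (Rmult_lt_compat_l e) in HN; [|exact He].
  replace (e * (2 / e)) with 2 in HN by (field; lra); exact HN. }
destruct (grid_dense N (fst (fst x))) as [u1 Hu1].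
destruct (grid_dense N (snd (fst x))) as [u2 Hu2].
destruct (grid_dense N (fst (snd x))) as [v1 Hv1].
destruct (grid_dense N (snd (snd x))) as [v2 Hv2].
exists (to_nat (N, to_nat (to_nat (u1, u2), to_nat (v1, v2)))).
unfold V; rewrite !cancel_of_to; split.
- exists x; split; [now repeat split | exact Hx].
- intros q [y [[[Y1 Y2] [Y3 Y4]] Hq]].
  assert (Hy : ball x e y).
  { assert (T : forall s t g, Rabs (s - g) < / (INR N + 1) ->
      Rabs (t - g) < / (INR N + 1) -> Rabs (t - s) < e).
    { intros s t g Hs Ht; apply Rabs_def2 in Hs; apply Rabs_def2 in Ht.
      apply Rabs_def1; lra. }
    split; split; eapply T; eassumption. }
  destruct (Hball y Hy) as [q' [Uq' Hq']].
  now rewrite (in_class_inj Hq Hq').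
Qed.

Lemma hopf_cover (p : hopf_pt a b) :
  exists c, hopf_atlas c /\ ch_dom c p.
Proof.
destruct (in_class_ex p) as [x Hx].
destruct (annulus_ex (in_class_nonzero Hx)) as [r Hr].
set (dom := fun q : hopf_pt a b => exists y, annulus r y /\ in_class q y).
set (coord := fun q : hopf_pt a b =>
  epsilon (inhabits zero2) (fun y => annulus r y /\ in_class q y)).
set (param := fun y : C2 =>
  epsilon (inhabits p) (fun q : hopf_pt a b => in_class q y)).
assert (HC : forall q, dom q -> annulus r (coord q) /\ in_class q (coord q)).
{ intros q Hq; unfold coord; apply epsilon_spec; exact Hq. }
exists (Chart dom coord param); split; [split|].
- assert (E : forall y, ch_image (Chart dom coord param) y <-> annulus r y).
  { intros y; unfold ch_image; simpl; split.
    - intros [q [Hq <-]]; now apply HC.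
    - intros Hy; pose (q := class_of (annulus_nonzero Hy)).
      assert (Q := class_of_in (annulus_nonzero Hy)); fold q in Q.
      assert (Dq : dom q) by now exists y.
      exists q; split; [exact Dq|].
      destruct (HC q Dq) as [A1 A2].
      destruct (proj1 (in_class_act (coord q) Q) A2) as [k Ek].
      assert (k = 0%Z).
      { apply (@annulus_unique r r y y); try assumption.
        - now rewrite <- Ek.
        - now rewrite act_0. }
      subst k; rewrite act_0 in Ek; exact Ek. }
  intros y Hy; apply E in Hy.
  generalize (@annulus_open r y Hy); apply filter_imp; intros u; apply E.
- simpl; intros q Hq; destruct (HC q Hq) as [_ H]; split; [exact H|].
  apply in_class_inj with (2 := H).
  unfold param; apply (epsilon_spec (inhabits p)
    (fun q' : hopf_pt a b => in_class q' (coord q))); now exists q.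
- simpl; now exists x.
Qed.

Lemma hopf_chart_homeo (c : chart (hopf_pt a b)) (U : hopf_pt a b -> Prop) :
  hopf_atlas c -> (forall p, U p -> ch_dom c p) ->
  (hopf_open U <-> open (fun x : C2 => exists p, U p /\ ch_coord c p = x)).
Proof.
intros [Hi Hc] HU; split.
- intros HO x [p [Up Ex]].
  assert (Hx : in_class p x) by (rewrite <- Ex; now apply Hc, HU).
  assert (Ix : ch_image c x) by (exists p; split; [now apply HU | exact Ex]).
  generalize (filter_and _ _ (HO x (ex_intro _ p (conj Up Hx))) (Hi x Ix)).
  apply filter_imp; intros y [[q [Uq Hq]] [q' [Dq' Eq']]].
  exists q'; split; [|exact Eq'].
  replace q' with q; [exact Uq|].
  apply in_class_inj with (1 := Hq); rewrite <- Eq'; now apply Hc.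
- intros HO; apply hopf_open_image in HO.
  replace U with (fun p : hopf_pt a b => exists x,
    (exists p0, U p0 /\ ch_coord c p0 = x) /\ in_class p x); [exact HO|].
  apply functional_extensionality; intros p; apply propositional_extensionality.
  split.
  + intros [x [[q [Uq <-]] Hp]].
    rewrite (in_class_inj Hp (proj1 (Hc q (HU q Uq)))); exact Uq.
  + intros Up; exists (ch_coord c p); split; [now exists p|].
    now apply Hc, HU.
Qed.

Lemma hopf_dom_open (c : chart (hopf_pt a b)) :
  hopf_atlas c -> hopf_open (ch_dom c).
Proof. intros Hc; apply (hopf_chart_homeo Hc); [auto | apply Hc]. Qed.

Lemma hopf_transition (c d : chart (hopf_pt a b)) p :
  hopf_atlas c -> hopf_atlas d -> ch_dom c p -> ch_dom d p ->
  exists k, locally (ch_coord c p : C * C) (fun x => transition c d x = act k x).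
Proof.
intros [Hci Hc] [Hdi Hd] Hcp Hdp.
destruct (proj1 (in_class_act (ch_coord d p) (proj1 (Hc p Hcp)))
  (proj1 (Hd p Hdp))) as [k Ek].
exists k.
assert (I1 : ch_image c (ch_coord c p)) by now exists p.
assert (I2 : ch_image d (act k (ch_coord c p)))
  by (rewrite <- Ek; now exists p).
generalize (filter_and _ _ (Hci _ I1) (open_act (k := k) Hdi I2)).
apply filter_imp; intros x [[q [Dq Eq]] [q' [Dq' Eq']]].
unfold transition; rewrite <- Eq at 1; rewrite (proj2 (Hc q Dq)), <- Eq'.
f_equal; apply in_class_inj with (2 := proj1 (Hd q' Dq')).
rewrite Eq'; apply (in_class_act _ (proj1 (Hc q Dq))).
exists k; now rewrite Eq.
Qed.

Lemma hopf_holomorphic (c d : chart (hopf_pt a b)) p :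
  hopf_atlas c -> hopf_atlas d -> ch_dom c p -> ch_dom d p ->
  ex_filterdiff (K := C_AbsRing)
    (transition c d : C * C -> C * C) (locally (ch_coord c p)).
Proof.
intros Hc Hd Hcp Hdp.
destruct (hopf_transition Hc Hd Hcp Hdp) as [k Hk].
apply (ex_filterdiff_ext_locally (K := C_AbsRing)
  (U := prod_NormedModule C_AbsRing C_NormedModule C_NormedModule)
  (V := prod_NormedModule C_AbsRing C_NormedModule C_NormedModule)
  (act k : C * C -> C * C)).
- generalize Hk; apply filter_imp; intros x Hx; now rewrite Hx.
- exists (act k : C * C -> C * C).
  apply (filterdiff_linear (K := C_AbsRing)
    (U := prod_NormedModule C_AbsRing C_NormedModule C_NormedModule)
    (V := prod_NormedModule C_AbsRing C_NormedModule C_NormedModule)).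
  apply act_linear.
Qed.

Definition hopf_surface : complex_surface :=
  @ComplexSurface (hopf_pt a b) (@hopf_open a b)
    hopf_open_full hopf_open_inter hopf_open_union
    hopf_hausdorff hopf_second_countable
    (@hopf_atlas a b) hopf_cover hopf_dom_open
    (fun c Hc => proj1 Hc)
    (fun c p Hc Hp => proj2 (proj2 Hc p Hp))
    hopf_chart_homeo hopf_holomorphic.

End HopfSurface.

(* Main.v *)
Require Import Defs.
From Stdlib Require Import Reals Lra ClassicalEpsilon.
From Coquelicot Require Import Coquelicot.
Set Implicit Arguments.
Unset Strict Implicit.
Unset Printing Implicit Defensive.
Open Scope R_scope.

(** On C^2 minus the origin let [t] be the function determined by

      |z|^2 e^(- c1 t) + |w|^2 e^(- c2 t) = 1,  c1 = 2 ln |a|,  c2 = 2 ln |b|.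

    Since |a|^2 = e^c1 and |b|^2 = e^c2, replacing (z, w) by (a z, b w) increases
    [t] by 1, so |dz|^2 e^(- c1 t) and |dw|^2 e^(- c2 t) are invariant and

      g = c2^2 e^(- c1 t) |dz|^2 + c1^2 e^(- c2 t) |dw|^2

    is a Hermitian metric on the Hopf surface.  (Up to normalization this is the
    Gauduchon-Ornea potential; [t] is [level] below, and e^(- ci t) is [weight].)

    Put p = |z|^2 e^(- c1 t), q = |w|^2 e^(- c2 t), so p + q = 1, and
    S = c1 p + c2 q > 0 ([speed]).  Differentiating the equation gives
    dt/dz = conj z e^(- c1 t) / S and dt/dw = conj w e^(- c2 t) / S, and
    differentiating again, the complex Hessian of [t] turns out to have rank one
    ([levi_form]):

      sum t_(i jbar) xi^i conj xi^j
        = e^(- (c1 + c2) t) / S^3 |c2 w xi^1 - c1 z xi^2|^2 >= 0.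

    The coefficients of [g] are constants times e^(- ck t) and [g] is diagonal,
    so R_(i jbar k kbar) = - g_k d_i dbar_j ln g_k = ck g_k t_(i jbar), and the
    components with k <> l vanish ([metric_curvature]).  The bisectional
    curvature is therefore a product of two nonnegative factors, one in xi and
    one in eta ([metric_bisectional]).

    A diagonal metric is Gauduchon when
    d_w dbar_w g_1 + d_z dbar_z g_2 = 0.  Here
    d_w dbar_w e^(- c1 t) = c1^2 (c2 q^2 - c1 p^2) e^(- (c1 + c2) t) / S^3, and
    exchanging the indices gives d_z dbar_z e^(- c2 t) as
    c2^2 (c1 p^2 - c2 q^2) e^(- (c1 + c2) t) / S^3;
    the factors c2^2 and c1^2 in [g] make the two cancel ([metric_balance]).

    For the analysis, [t] exists because the left-hand side of its equation is
    strictly decreasing in [t]; its derivative along a real line is obtained from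
    difference quotients ([level_derive]).  All functions that occur lie in the
    algebra generated by constants, the coordinates, their conjugates, the
    weights and 1 / S, and Wirtinger derivatives preserve this algebra.  Treating
    its elements as formal expressions ([expr]) gives smoothness by induction and
    turns the curvature into identities of rational functions. *)

(** * Difference quotients and continuity *)

(** Caratheodory's form of differentiability: a difference quotient that extends
    continuously to the point.  It avoids an implicit function theorem for
    [level], whose quotient solves a linear equation. *)
Lemma is_derive_of_slope (f psi : R -> R) (x : R) :
  continuous psi x ->
  locally x (fun y => f y - f x = psi y * (y - x)) -> is_derive f x (psi x).
Proof.
intros Hpsi Hf; apply is_derive_Reals; intros eps Heps.
destruct (filter_and _ _ Hf (proj1 (filterlim_locally psi (psi x)) Hpsi
  (mkposreal eps Heps))) as [d Hd].
exists d; intros h h0 Hh.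
destruct (Hd (x + h)) as [E B].
{ change (Rabs (x + h - x) < d); now replace (x + h - x) with h by ring. }
rewrite E; replace (psi (x + h) * (x + h - x) / h) with (psi (x + h))
  by (field; exact h0).
exact B.
Qed.

(** The value [l] on the diagonal is meant to be the derivative at [x]. *)
Definition slope (f : R -> R) (l x y : R) : R :=
  if Req_EM_T y x then l else (f y - f x) / (y - x).

Lemma slopeE f l x y : f y - f x = slope f l x y * (y - x).
Proof.
unfold slope; destruct (Req_EM_T y x) as [->|H]; [ring | field; lra].
Qed.

Lemma slope_id f l x : slope f l x x = l.
Proof. unfold slope; destruct (Req_EM_T x x); [reflexivity | contradiction]. Qed.

Lemma slope_continuous f l x : is_derive f x l -> continuous (slope f l x) x.
Proof.
intros H; apply is_derive_Reals in H; apply filterlim_locally; intros eps.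
rewrite slope_id; destruct (H eps (cond_pos eps)) as [d Hd]; exists d.
intros y Hy; unfold slope; destruct (Req_EM_T y x) as [E|E].
{ apply ball_center. }
assert (B := Hd (y - x)).
rewrite Rplus_minus in B.
apply B; [lra | exact Hy].
Qed.

Section Continuity.

Variable U : UniformSpace.
Implicit Types f g : U -> R.

Lemma cont_plus f g x :
  continuous f x -> continuous g x -> continuous (fun y => f y + g y) x.
Proof. apply (continuous_plus (V := R_NormedModule)). Qed.

Lemma cont_minus f g x :
  continuous f x -> continuous g x -> continuous (fun y => f y - g y) x.
Proof. apply (continuous_minus (V := R_NormedModule)). Qed.

Lemma cont_mult f g x :
  continuous f x -> continuous g x -> continuous (fun y => f y * g y) x.
Proof. apply (continuous_mult (K := R_AbsRing)). Qed.

Lemma cont_opp f x : continuous f x -> continuous (fun y => - f y) x.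
Proof. apply (continuous_opp (V := R_NormedModule)). Qed.

Lemma cont_inv f x :
  continuous f x -> f x <> 0 -> continuous (fun y => / f y) x.
Proof.
intros Hf H; apply (continuous_comp f Rinv); [exact Hf | now apply continuous_Rinv].
Qed.

Lemma cont_exp f x : continuous f x -> continuous (fun y => exp (f y)) x.
Proof. intros Hf; apply (continuous_comp f exp); [exact Hf | apply continuous_exp]. Qed.

Lemma cont_complex (f : U -> C) x :
  continuous f x <->
  continuous (fun y => Re (f y)) x /\ continuous (fun y => Im (f y)) x.
Proof.
split.
- intros Hf; split; [apply (continuous_comp f Re) | apply (continuous_comp f Im)];
    try exact Hf; [apply (continuous_fst (V := R_UniformSpace))
                  | apply (continuous_snd (U := R_UniformSpace))].
- intros [H1 H2].
  intros P [e He]. 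
  generalize (filter_and _ _ (proj1 (filterlim_locally _ _) H1 e)
    (proj1 (filterlim_locally _ _) H2 e)).
  unfold filtermap; apply filter_imp; intros y [B1 B2]; apply He; now split.
Qed.

Lemma locally_lt f x r :
  continuous f x -> f x < r -> locally x (fun y => f y < r).
Proof. intros Hf H; apply (Hf (fun t => t < r)), open_lt, H. Qed.

Lemma locally_gt f x r :
  continuous f x -> r < f x -> locally x (fun y => r < f y).
Proof. intros Hf H; apply (Hf (fun t => r < t)), open_gt, H. Qed.

End Continuity.

(** * Coordinates and real lines in C^2 *)

Lemma co_continuous i (x : C2) : continuous (co i : C * C -> C) x.
Proof. destruct i; [apply continuous_fst | apply continuous_snd]. Qed.

Definition sqnorm (i : idx) (x : C2) : R := Re (co i x) ^ 2 + Im (co i x) ^ 2.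

Lemma sqnorm_ge0 i x : 0 <= sqnorm i x.
Proof. unfold sqnorm; generalize (pow2_ge_0 (Re (co i x))) (pow2_ge_0 (Im (co i x))); lra. Qed.

Lemma sqnorm_Cmod i x : sqnorm i x = Cmod (co i x) ^ 2.
Proof. symmetry; apply pow2_sqrt, sqnorm_ge0. Qed.

Lemma sqnormE i x : RtoC (sqnorm i x) = (co i x * Cconj (co i x))%C.
Proof.
unfold sqnorm; destruct (co i x) as [u v]; unfold RtoC, Cmult, Cconj; simpl.
f_equal; ring.
Qed.

Lemma sqnorm_continuous i (x : C2) :
  continuous (sqnorm i : C * C -> R) x.
Proof.
destruct (proj1 (cont_complex (co i : C * C -> C) x) (@co_continuous i x))
  as [H1 H2].
unfold sqnorm; apply cont_plus; simpl; repeat apply cont_mult; try assumption;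
  apply continuous_const.
Qed.

Lemma sqnorm_pos x : x <> zero2 <-> 0 < sqnorm i1 x + sqnorm i2 x.
Proof.
split.
- intros H; destruct (Rle_lt_dec (sqnorm i1 x + sqnorm i2 x) 0) as [N|N];
    [|exact N].
  exfalso; apply H; generalize (sqnorm_ge0 i1 x) (sqnorm_ge0 i2 x); intros A B.
  assert (E : forall i, sqnorm i x = 0) by (intros []; lra).
  destruct x as [z w]; unfold zero2; f_equal; apply Cmod_eq_0, Rsqr_0_uniq;
    unfold Rsqr.
  + generalize (E i1); rewrite sqnorm_Cmod; simpl; lra.
  + generalize (E i2); rewrite sqnorm_Cmod; simpl; lra.
- intros H ->; unfold sqnorm in H; simpl in H; lra.
Qed.

Lemma sqnorm_combination_pos x r s : x <> zero2 -> 0 < r -> 0 < s ->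
  0 < r * sqnorm i1 x + s * sqnorm i2 x.
Proof.
intros Hx Hr Hs; apply sqnorm_pos in Hx.
assert (H1 := sqnorm_ge0 i1 x); assert (H2 := sqnorm_ge0 i2 x).
assert (T1 := Rmult_le_pos _ _ (Rlt_le _ _ Hr) H1).
assert (T2 := Rmult_le_pos _ _ (Rlt_le _ _ Hs) H2).
destruct H1 as [H1|H1].
- apply (Rmult_lt_0_compat _ _ Hr) in H1; lra.
- assert (H : 0 < sqnorm i2 x) by lra.
  apply (Rmult_lt_0_compat _ _ Hs) in H; lra.
Qed.

Lemma open_nonzero : open (fun x : C * C => x <> zero2).
Proof.
apply open_ext with (fun x : C * C => 0 < sqnorm i1 x + sqnorm i2 x).
{ intros x; symmetry; apply sqnorm_pos. }
apply (open_comp (fun x : C * C => sqnorm i1 x + sqnorm i2 x) (fun t => 0 < t));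
  [|apply open_gt].
intros x _; apply cont_plus; apply sqnorm_continuous.
Qed.

Lemma line_continuous (x v : C2) (s : R) :
  continuous (fun r => line x v r : C * C) s.
Proof.
assert (L : forall z u : C, continuous (fun r : R => (z + r * u)%C) s).
{ intros z u; apply cont_complex; split; simpl;
  [apply cont_plus | apply cont_plus]; try apply continuous_const;
  [apply cont_minus | apply cont_plus]; apply cont_mult;
  try apply continuous_const; try apply continuous_id. }
intros P [e He].
generalize (filter_and _ _ (proj1 (filterlim_locally _ _) (L (fst x) (fst v)) e)
  (proj1 (filterlim_locally _ _) (L (snd x) (snd v)) e)).
unfold filtermap; apply filter_imp; intros r [B1 B2]; apply He; now split.
Qed.

Lemma line_0 x v : line x v 0 = x.
Proof. destruct x; unfold line; simpl; f_equal; ring. Qed.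

Lemma locally_line (D : C2 -> Prop) (x v : C2) :
  locally (x : C * C) D -> locally 0 (fun s : R => D (line x v s)).
Proof.
intros H; apply (@line_continuous x v 0); now rewrite line_0.
Qed.

(** * The level function *)

Section Level.

Variable c : idx -> R.
Hypothesis c_pos : forall i, 0 < c i.

(** At [s] equal to 0 this is the squared norm of [x]; [level] picks the [s] at
    which the flow of weights [- c i / 2] carries [x] to the unit sphere. *)
Definition gauge (x : C2) (s : R) : R :=
  sqnorm i1 x * exp (- c i1 * s) + sqnorm i2 x * exp (- c i2 * s).

Lemma gauge_decreasing x s t : x <> zero2 -> s < t -> gauge x t < gauge x s.
Proof.
intros Hx Hst; unfold gauge.
assert (E : forall i, 0 < exp (- c i * s) - exp (- c i * t)).
{ intros i; apply Rlt_0_minus, exp_increasing.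
  generalize (Rmult_lt_compat_l _ _ _ (c_pos i) Hst); lra. }
generalize (sqnorm_combination_pos Hx (E i1) (E i2)); lra.
Qed.

Lemma gauge_inj x s t : x <> zero2 -> gauge x s = gauge x t -> s = t.
Proof.
intros Hx E; destruct (Rtotal_order s t) as [H|[H|H]]; [|exact H|];
  apply (gauge_decreasing Hx) in H; lra.
Qed.

Lemma gauge_continuous s (x : C2) :
  continuous (fun y : C * C => gauge y s) x.
Proof.
apply cont_plus; apply cont_mult; try apply sqnorm_continuous;
  apply continuous_const.
Qed.

Lemma gauge_root x : x <> zero2 -> exists s, gauge x s = 1.
Proof.
intros Hx.
(* A coordinate that does not vanish makes its own term equal to 1. *)
assert (L : exists s, 1 <= gauge x s).
{ assert (K : forall i, 0 < sqnorm i x ->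
    sqnorm i x * exp (- c i * (ln (sqnorm i x) / c i)) = 1).
  { intros i Hi; assert (Hci := c_pos i).
    replace (- c i * (ln (sqnorm i x) / c i)) with (- ln (sqnorm i x))
      by (field; lra).
    rewrite exp_Ropp, exp_ln by exact Hi; field; lra. }
  assert (P : forall i s, 0 <= sqnorm i x * exp (- c i * s)).
  { intros i s; apply Rmult_le_pos; [apply sqnorm_ge0|].
    apply Rlt_le, exp_pos. }
  destruct (Rle_lt_or_eq_dec _ _ (sqnorm_ge0 i1 x)) as [H|H].
  - exists (ln (sqnorm i1 x) / c i1); unfold gauge; rewrite (K i1 H).
    generalize (P i2 (ln (sqnorm i1 x) / c i1)); lra.
  - assert (H' : 0 < sqnorm i2 x) by (apply sqnorm_pos in Hx; lra).
    exists (ln (sqnorm i2 x) / c i2); unfold gauge; rewrite (K i2 H').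
    generalize (P i1 (ln (sqnorm i2 x) / c i2)); lra. }
(* For large [s] each term is at most 1/2; the summand 1 below keeps the
   logarithm meaningful when the coordinate vanishes. *)
assert (M : exists s, gauge x s <= 1).
{ assert (K : forall i, exists t, forall s, t <= s ->
    sqnorm i x * exp (- c i * s) <= / 2).
  { intros i; assert (Hi := sqnorm_ge0 i x); assert (Hci := c_pos i).
    set (t := ln (2 * sqnorm i x + 1) / c i); exists t; intros s Hs.
    assert (Et : exp (- c i * t) = / (2 * sqnorm i x + 1)).
    { unfold t; replace (- c i * (ln (2 * sqnorm i x + 1) / c i))
        with (- ln (2 * sqnorm i x + 1)) by (field; lra).
      rewrite exp_Ropp, exp_ln by lra; reflexivity. }
    assert (Es : exp (- c i * s) <= exp (- c i * t)).
    { apply Rnot_lt_le; intros N; apply exp_lt_inv in N.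
      generalize (Rmult_le_compat_l (c i) _ _ (Rlt_le _ _ Hci) Hs); lra. }
    apply Rle_trans with (sqnorm i x * / (2 * sqnorm i x + 1)).
    - rewrite <- Et; now apply Rmult_le_compat_l.
    - apply Rmult_le_reg_r with (2 * sqnorm i x + 1); [lra|].
      rewrite Rmult_assoc, Rinv_l by lra; lra. }
  destruct (K i1) as [t1 H1], (K i2) as [t2 H2]; exists (Rmax t1 t2).
  unfold gauge; generalize (H1 _ (Rmax_l t1 t2)) (H2 _ (Rmax_r t1 t2)); lra. }
destruct L as [s Hs], M as [t Ht].
destruct (@IVT_gen_consistent (gauge x) s t 1) as [r [_ Hr]].
- intros r; unfold gauge; apply cont_plus; apply cont_mult;
    try apply continuous_const; apply cont_exp, cont_mult;
    [apply continuous_const | apply continuous_id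
    |apply continuous_const | apply continuous_id].
- split; [apply Rle_trans with (2 := Ht), Rmin_r
         |apply Rle_trans with (1 := Hs), Rmax_l].
- now exists r.
Qed.

Definition level (x : C2) : R :=
  epsilon (inhabits 0) (fun s => gauge x s = 1).

Lemma gauge_level x : x <> zero2 -> gauge x (level x) = 1.
Proof.
intros Hx; apply (epsilon_spec (inhabits 0) (fun s => gauge x s = 1)).
now apply gauge_root.
Qed.

Lemma level_eq x s : x <> zero2 -> gauge x s = 1 -> level x = s.
Proof.
intros Hx Hs; apply (gauge_inj Hx); rewrite Hs; now apply gauge_level.
Qed.

(** By monotonicity, [level y] lies within [eps] of [level x] as soon as
    [gauge y] exceeds 1 at [level x - eps] and is below 1 at [level x + eps];
    both conditions are open in [y]. *)
Lemma level_continuous (x : C2) :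
  x <> zero2 -> continuous (level : C * C -> R) x.
Proof.
intros Hx; apply filterlim_locally; intros eps.
assert (He := cond_pos eps).
assert (A : locally (x : C * C) (fun y => 1 < gauge y (level x - eps))).
{ apply locally_gt; [apply gauge_continuous|].
  rewrite <- (gauge_level Hx); apply gauge_decreasing; [exact Hx | lra]. }
assert (B : locally (x : C * C) (fun y => gauge y (level x + eps) < 1)).
{ apply locally_lt; [apply gauge_continuous|].
  rewrite <- (gauge_level Hx); apply gauge_decreasing; [exact Hx | lra]. }
generalize (filter_and _ _ (filter_and _ _ A B) (open_nonzero Hx)).
apply filter_imp; intros y [[A' B'] Hy].
assert (E := gauge_level Hy).
apply Rabs_def1; apply Rnot_le_lt; intros N; revert E.
- assert (N' : level x + eps <= level y).
  { unfold minus, plus, opp in N; simpl in N; lra. }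
  destruct N' as [N'|N']; [apply (gauge_decreasing Hy) in N'|rewrite <- N']; lra.
- assert (N' : level y <= level x - eps).
  { unfold minus, plus, opp in N; simpl in N; lra. }
  destruct N' as [N'|N']; [apply (gauge_decreasing Hy) in N'|rewrite N']; lra.
Qed.

Definition weight (i : idx) (x : C2) : R := exp (- c i * level x).

(** Minus the derivative of [gauge x] at [level x]. *)
Definition speed (x : C2) : R :=
  c i1 * sqnorm i1 x * weight i1 x + c i2 * sqnorm i2 x * weight i2 x.

Lemma weight_sum x : x <> zero2 ->
  sqnorm i1 x * weight i1 x + sqnorm i2 x * weight i2 x = 1.
Proof. apply gauge_level. Qed.

Lemma speed_pos x : x <> zero2 -> 0 < speed x.
Proof.
intros Hx.
assert (P : forall i, 0 < c i * weight i x).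
{ intros i; apply Rmult_lt_0_compat; [apply c_pos | apply exp_pos]. }
generalize (sqnorm_combination_pos Hx (P i1) (P i2)); unfold speed; lra.
Qed.

(** The real inner product of the coordinates [i]: half the derivative of
    [sqnorm i] in the direction [v]. *)
Definition rdot (i : idx) (x v : C2) : R :=
  Re (co i x) * Re (co i v) + Im (co i x) * Im (co i v).

Lemma sqnorm_line i x v s :
  sqnorm i (line x v s) = sqnorm i x + s * (2 * rdot i x v + s * sqnorm i v).
Proof.
unfold sqnorm, rdot; destruct i, x as [[] []], v as [[] []]; simpl; ring.
Qed.

(** Implicit differentiation.  Subtracting the equations of [level] at
    [line x v s] and at [x] and writing each difference as a difference quotient
    times an increment gives [s * N s + M s * (tau s - tau 0) = 0], where [N] is
    the sum of the [num i] below; [N] and [M] are continuous at 0, and [M 0],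
    which is [- speed x], is nonzero. *)
Lemma level_derive x v : x <> zero2 ->
  is_derive (fun s => level (line x v s)) 0
    (2 * (rdot i1 x v * weight i1 x + rdot i2 x v * weight i2 x) / speed x).
Proof.
intros Hx.
set (tau := fun s => level (line x v s)).
assert (tau0 : tau 0 = level x) by (unfold tau; now rewrite line_0).
assert (tau_cont : continuous tau 0).
{ apply (continuous_comp (fun s => line x v s : C * C) level).
  - apply line_continuous.
  - rewrite line_0; now apply level_continuous. }
set (sl := fun i => slope (fun t => exp (- c i * t)) (- c i * weight i x) (level x)).
assert (sl_cont : forall i, continuous (fun s => sl i (tau s)) 0).
{ intros i; apply (continuous_comp tau (sl i)); [exact tau_cont|].
  rewrite tau0; apply slope_continuous; unfold weight; auto_derive; [exact I|ring]. }
set (num := fun i s => (2 * rdot i x v + s * sqnorm i v) * exp (- c i * tau s)).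
assert (num_cont : forall i, continuous (num i) 0).
{ intros i; apply cont_mult.
  - apply cont_plus; [apply continuous_const|].
    apply cont_mult; [apply continuous_id | apply continuous_const].
  - apply cont_exp, cont_mult; [apply continuous_const | exact tau_cont]. }
set (M := fun s => sqnorm i1 x * sl i1 (tau s) + sqnorm i2 x * sl i2 (tau s)).
assert (M_cont : continuous M 0).
{ apply cont_plus; apply cont_mult; try apply continuous_const; apply sl_cont. }
assert (M0 : M 0 = - speed x).
{ unfold M, sl; rewrite tau0, !slope_id; unfold speed; ring. }
assert (HM : M 0 < 0) by (rewrite M0; generalize (speed_pos Hx); lra).
set (psi := fun s => - (num i1 s + num i2 s) * / M s).
replace (2 * (rdot i1 x v * weight i1 x + rdot i2 x v * weight i2 x) / speed x)
  with (psi 0).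
2: { unfold psi, num; rewrite M0, tau0; fold (weight i1 x) (weight i2 x).
  assert (S := speed_pos Hx); field; lra. }
apply is_derive_of_slope.
- apply cont_mult; [apply cont_opp, cont_plus; apply num_cont|].
  apply cont_inv; [exact M_cont | lra].
- assert (N : locally (x : C * C) (fun y => y <> zero2)) by now apply open_nonzero.
  apply (@locally_line _ x v) in N.
  generalize (filter_and _ _ N (locally_lt M_cont HM)).
  apply filter_imp; intros s [Hs HMs].
  assert (E := gauge_level Hs); rewrite <- (gauge_level Hx) in E; unfold gauge in E.
  rewrite !sqnorm_line in E; fold (tau s) in E.
  change (tau s - tau 0 = psi s * (s - 0)); rewrite tau0.
  assert (K : s * (num i1 s + num i2 s) + M s * (tau s - level x) = 0).
  { unfold M; rewrite Rmult_plus_distr_r, !Rmult_assoc; unfold sl.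
    rewrite <- !slopeE; unfold num; lra. }
  unfold psi; apply Rmult_eq_reg_l with (M s); [|lra].
  replace (M s * (- (num i1 s + num i2 s) * / M s * (s - 0)))
    with (- (s * (num i1 s + num i2 s))) by (field; lra).
  lra.
Qed.

End Level.

(** * Directional and Wirtinger derivatives *)

Definition has_dir (f : C2 -> C) (x v : C2) (l : C) : Prop :=
  is_derive (fun s => Re (f (line x v s))) 0 (Re l) /\
  is_derive (fun s => Im (f (line x v s))) 0 (Im l).

Lemma has_dir_ex f x v l : has_dir f x v l -> ex_dir v f x.
Proof. intros [H1 H2]; split; [exists (Re l) | exists (Im l)]; assumption. Qed.

Lemma has_dirE f x v l : has_dir f x v l -> dir v f x = l.
Proof.
intros [H1 H2]; destruct l; unfold dir; f_equal; now apply is_derive_unique.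
Qed.

Lemma has_dir_real (f : C2 -> R) x v l :
  is_derive (fun s => f (line x v s)) 0 l ->
  has_dir (fun y => RtoC (f y)) x v (RtoC l).
Proof.
intros H; split; [exact H|].
exact (is_derive_const (K := R_AbsRing) (V := R_NormedModule) 0 0).
Qed.

Lemma has_dir_const z x v : has_dir (fun _ => z) x v (RtoC 0).
Proof.
split; exact (is_derive_const (K := R_AbsRing) (V := R_NormedModule) _ 0).
Qed.

Lemma has_dir_co i x v : has_dir (co i) x v (co i v).
Proof.
destruct i, x as [[] []], v as [[] []]; split; simpl; auto_derive;
  try exact I; simpl; ring.
Qed.

Lemma has_dir_conj f x v l :
  has_dir f x v l -> has_dir (fun y => Cconj (f y)) x v (Cconj l).
Proof.
intros [H1 H2]; split; [exact H1|].
exact (is_derive_opp (K := R_AbsRing) (V := R_NormedModule) _ _ _ H2).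
Qed.

Lemma has_dir_plus f g x v l m :
  has_dir f x v l -> has_dir g x v m ->
  has_dir (fun y => f y + g y)%C x v (l + m)%C.
Proof.
intros [H1 H2] [H3 H4]; split.
- exact (is_derive_plus (K := R_AbsRing) (V := R_NormedModule) _ _ _ _ _ H1 H3).
- exact (is_derive_plus (K := R_AbsRing) (V := R_NormedModule) _ _ _ _ _ H2 H4).
Qed.

Lemma is_derive_Rmult (f g : R -> R) s l m :
  is_derive f s l -> is_derive g s m ->
  is_derive (fun t => f t * g t) s (l * g s + f s * m).
Proof.
intros Hf Hg; apply (is_derive_mult (K := R_AbsRing) f g s l m Hf Hg).
exact Rmult_comm.
Qed.

Lemma has_dir_mult f g x v l m :
  has_dir f x v l -> has_dir g x v m ->
  has_dir (fun y => f y * g y)%C x v (l * g x + f x * m)%C.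
Proof.
intros [H1 H2] [H3 H4].
assert (A := is_derive_Rmult H1 H3); assert (B := is_derive_Rmult H2 H4).
assert (E := is_derive_Rmult H1 H4); assert (F := is_derive_Rmult H2 H3).
cbv beta in A, B, E, F; rewrite line_0 in A, B, E, F; split.
- replace (Re (l * g x + f x * m)%C) with
    ((Re l * Re (g x) + Re (f x) * Re m) - (Im l * Im (g x) + Im (f x) * Im m))
    by (destruct l, m, (f x), (g x); simpl; ring).
  exact (is_derive_minus (K := R_AbsRing) (V := R_NormedModule) _ _ _ _ _ A B).
- replace (Im (l * g x + f x * m)%C) with
    ((Re l * Im (g x) + Re (f x) * Im m) + (Im l * Re (g x) + Im (f x) * Re m))
    by (destruct l, m, (f x), (g x); simpl; ring).
  exact (is_derive_plus (K := R_AbsRing) (V := R_NormedModule) _ _ _ _ _ E F).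
Qed.

Lemma has_dir_ext D f g x v l :
  locally (x : C * C) D -> (forall y, D y -> f y = g y) ->
  has_dir f x v l -> has_dir g x v l.
Proof.
intros HD E [H1 H2]; apply (@locally_line _ x v) in HD.
split; [revert H1 | revert H2]; apply is_derive_ext_loc; generalize HD;
  apply filter_imp; intros s Hs; now rewrite (E _ Hs).
Qed.

Lemma dir_ext (D : C2 -> Prop) f g x v :
  locally (x : C * C) D -> (forall y, D y -> f y = g y) -> dir v f x = dir v g x.
Proof.
intros HD E; apply (@locally_line _ x v) in HD; unfold dir.
f_equal; apply Derive_ext_loc; generalize HD; apply filter_imp; intros s Hs;
  now rewrite (E _ Hs).
Qed.

Lemma dz_ext (D : C2 -> Prop) f g x i :
  locally (x : C * C) D -> (forall y, D y -> f y = g y) -> dz i f x = dz i g x.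
Proof. intros HD E; unfold dz; now rewrite !(dir_ext _ HD E). Qed.

Lemma Ck_ext (D : C2 -> Prop) n f g :
  open (D : C * C -> Prop) -> (forall y, D y -> f y = g y) ->
  Ck n D f -> Ck n D g.
Proof.
intros HD; revert f g; induction n as [|n IH]; intros f g E [Hc Hd].
all: assert (Hc' : forall x, D x -> continuous g x).
1, 3: intros x Hx; apply continuous_ext_loc with (2 := Hc x Hx);
  generalize (HD x Hx); apply filter_imp; exact E.
{ now split. }
split; [exact Hc'|]; intros i; destruct (Hd i) as [H1 [H2 H3]]; split; [|split].
- assert (K : forall x v, D x -> ex_dir v f x -> ex_dir v g x).
  { intros x v Hx [A B]; assert (L := HD x Hx); apply (@locally_line _ x v) in L.
    split; [revert A | revert B]; apply ex_derive_ext_loc; generalize L;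
      apply filter_imp; intros s Hs; now rewrite (E _ Hs). }
  intros x Hx; destruct (H1 x Hx); split; now apply K.
- revert H2; apply IH; intros x Hx; apply dir_ext with D; auto.
- revert H3; apply IH; intros x Hx; apply dir_ext with D; auto.
Qed.

(** The differential of [f] at [x] is [sum_i p i dz^i + q i d(zbar)^i]. *)
Definition wirtinger (f : C2 -> C) (x : C2) (p q : idx -> C) : Prop :=
  forall v, has_dir f x v
    (sum2 (fun i => p i * co i v + q i * Cconj (co i v))%C).

Lemma dz_wirtinger f x p q i : wirtinger f x p q -> dz i f x = p i.
Proof.
intros H; unfold dz; rewrite !(has_dirE (H _)).
destruct i; unfold sum2, basis, ibasis; simpl.
- destruct (p i1), (p i2), (q i1), (q i2).
  apply injective_projections; simpl; field.
- destruct (p i1), (p i2), (q i1), (q i2).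
  apply injective_projections; simpl; field.
Qed.

Lemma dzb_wirtinger f x p q i : wirtinger f x p q -> dzb i f x = q i.
Proof.
intros H; unfold dzb; rewrite !(has_dirE (H _)).
destruct i; unfold sum2, basis, ibasis; simpl;
  destruct (p i1), (p i2), (q i1), (q i2);
  apply injective_projections; simpl; field.
Qed.

(** * An algebra of functions closed under Wirtinger derivatives *)

Section Expressions.

Variable c : idx -> R.
Hypothesis c_pos : forall i, 0 < c i.

(** Reifying the functions makes derivatives of every order available by
    recursion, with no differentiability side conditions. *)
Inductive expr :=
  | Cst (z : C)
  | Coord (i : idx)
  | Conj (i : idx)
  | Weight (i : idx)
  | InvSpeed
  | Add (e f : expr)
  | Mul (e f : expr).

Fixpoint eval (e : expr) (x : C2) : C :=
  match e with
  | Cst z => z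
  | Coord i => co i x
  | Conj i => Cconj (co i x)
  | Weight i => RtoC (weight c i x)
  | InvSpeed => (/ RtoC (speed c x))%C
  | Add e f => (eval e x + eval f x)%C
  | Mul e f => (eval e x * eval f x)%C
  end.

Inductive kind := Hol | Antihol.

Definition kron (i j : idx) : C :=
  match i, j with i1, i1 | i2, i2 => RtoC 1 | _, _ => RtoC 0 end.

(** The derivatives d/dz^i and d/d(zbar)^i of [level c]. *)
Definition level_deriv (h : kind) (i : idx) : expr :=
  Mul (match h with Hol => Conj i | Antihol => Coord i end)
      (Mul (Weight i) InvSpeed).

(** The derivatives of [speed c]; [level_deriv] enters through the weights. *)
Definition speed_deriv (h : kind) (i : idx) : expr :=
  let term j := Mul (Cst (RtoC (- c j * c j)))
                    (Mul (Coord j) (Mul (Conj j) (Weight j))) in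
  Add (Mul (Cst (RtoC (c i)))
           (Mul (match h with Hol => Conj i | Antihol => Coord i end) (Weight i)))
      (Mul (Add (term i1) (term i2)) (level_deriv h i)).

Fixpoint deriv (h : kind) (i : idx) (e : expr) : expr :=
  match e with
  | Cst _ => Cst (RtoC 0)
  | Coord j => Cst (match h with Hol => kron i j | Antihol => RtoC 0 end)
  | Conj j => Cst (match h with Hol => RtoC 0 | Antihol => kron i j end)
  | Weight j => Mul (Cst (RtoC (- c j))) (Mul (Weight j) (level_deriv h i))
  | InvSpeed =>
      Mul (Cst (- RtoC 1)%C) (Mul InvSpeed (Mul InvSpeed (speed_deriv h i)))
  | Add e f => Add (deriv h i e) (deriv h i f)
  | Mul e f => Add (Mul (deriv h i e) f) (Mul e (deriv h i f))
  end.

Lemma speed_neq0 x : x <> zero2 -> RtoC (speed c x) <> RtoC 0.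
Proof. intros Hx E; apply RtoC_inj in E; generalize (speed_pos c_pos Hx); lra. Qed.

(** The complex form of the differential of a combination of the squared norms
    with coefficients [a]. *)
Lemma sum_rdot (a : idx -> R) x v :
  sum2 (fun i => RtoC (a i) * (Cconj (co i x) * co i v + co i x * Cconj (co i v)))%C
  = RtoC (2 * (rdot i1 x v * a i1 + rdot i2 x v * a i2)).
Proof.
unfold sum2, rdot; destruct x as [[] []], v as [[] []].
apply injective_projections; simpl; ring.
Qed.

Lemma weight_derive j x v l :
  is_derive (fun s => level c (line x v s)) 0 l ->
  is_derive (fun s => weight c j (line x v s)) 0 (- c j * weight c j x * l).
Proof.
intros H.
assert (E : is_derive (fun t => exp (- c j * t)) (level c (line x v 0))
  (- c j * exp (- c j * level c (line x v 0)))) by (auto_derive; [exact I | ring]).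
replace (- c j * weight c j x * l)
  with (l * (- c j * exp (- c j * level c (line x v 0)))).
- exact (is_derive_comp (K := R_AbsRing) (V := R_NormedModule) _ _ _ _ _ E H).
- rewrite line_0; unfold weight; ring.
Qed.

Lemma speed_derive x v l :
  is_derive (fun s => level c (line x v s)) 0 l ->
  is_derive (fun s => speed c (line x v s)) 0
    (2 * (rdot i1 x v * (c i1 * weight c i1 x) + rdot i2 x v * (c i2 * weight c i2 x))
     - (c i1 * c i1 * sqnorm i1 x * weight c i1 x +
        c i2 * c i2 * sqnorm i2 x * weight c i2 x) * l).
Proof.
intros H.
assert (Q : forall i,
  is_derive (fun s => c i * sqnorm i (line x v s)) 0 (c i * (2 * rdot i x v))).
{ intros i; apply is_derive_ext with
    (fun s => c i * (sqnorm i x + s * (2 * rdot i x v + s * sqnorm i v))).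
  - intros s; now rewrite sqnorm_line.
  - auto_derive; [exact I | ring]. }
assert (T := fun i => is_derive_Rmult (Q i) (weight_derive i H)).
assert (T1 := T i1); assert (T2 := T i2); cbv beta in T1, T2.
rewrite line_0 in T1, T2.
match goal with |- is_derive _ _ ?r => replace r with
  ((c i1 * (2 * rdot i1 x v) * weight c i1 x +
    c i1 * sqnorm i1 x * (- c i1 * weight c i1 x * l)) +
   (c i2 * (2 * rdot i2 x v) * weight c i2 x +
    c i2 * sqnorm i2 x * (- c i2 * weight c i2 x * l))) by ring end.
exact (is_derive_plus (K := R_AbsRing) (V := R_NormedModule) _ _ _ _ _ T1 T2).
Qed.

(** The formal derivatives are the true ones.  The generators carry the content:
    for [Weight] and [InvSpeed] it is the derivative of [level c]. *)
Lemma eval_wirtinger e x : x <> zero2 ->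
  wirtinger (eval e) x (fun i => eval (deriv Hol i e) x)
    (fun i => eval (deriv Antihol i e) x).
Proof.
intros Hx v.
assert (L := level_derive c_pos v Hx).
set (l := 2 * (rdot i1 x v * weight c i1 x + rdot i2 x v * weight c i2 x)
          / speed c x) in L.
assert (S := speed_neq0 Hx).
assert (EL : sum2 (fun i => eval (level_deriv Hol i) x * co i v +
  eval (level_deriv Antihol i) x * Cconj (co i v))%C = RtoC l).
{ unfold l, Rdiv; rewrite RtoC_mult, <- (sum_rdot (fun i => weight c i x)).
  rewrite RtoC_inv.
  2: { generalize (speed_pos c_pos Hx); lra. }
  unfold sum2; simpl; ring. }
induction e as [z|i|i|j| |e IHe f IHf|e IHe f IHf]; simpl.
- replace (sum2 _) with (RtoC 0) by (unfold sum2; ring); apply has_dir_const.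
- replace (sum2 _) with (co i v); [apply has_dir_co|].
  unfold sum2; destruct i; simpl; ring.
- replace (sum2 _) with (Cconj (co i v)); [apply has_dir_conj, has_dir_co|].
  unfold sum2; destruct i; simpl; ring.
- replace (sum2 _) with (RtoC (- c j * weight c j x * l)).
  + apply (has_dir_real (f := weight c j)), weight_derive, L.
  + rewrite RtoC_mult, <- EL, RtoC_mult; unfold sum2; simpl; ring.
- apply (@has_dir_ext (fun y => y <> zero2) (fun y => RtoC (/ speed c y))).
  { now apply open_nonzero. }
  { intros y Hy; apply RtoC_inv; generalize (speed_pos c_pos Hy); lra. }
  assert (D := speed_derive L).
  set (m := _ - _) in D.
  replace (sum2 _) with (RtoC (- m * / speed c x * / speed c x)).
  + apply (has_dir_real (f := fun y => / speed c y)).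
    assert (I := is_derive_inv (fun s => speed c (line x v s)) 0 m D).
    cbv beta in I; rewrite line_0 in I.
    replace (- m * / speed c x * / speed c x) with (- m / speed c x ^ 2).
    * apply I; generalize (speed_pos c_pos Hx); lra.
    * field; generalize (speed_pos c_pos Hx); lra.
  + rewrite !RtoC_mult, RtoC_inv, RtoC_opp
      by (generalize (speed_pos c_pos Hx); lra).
    unfold m; rewrite RtoC_minus, (RtoC_mult _ l), <- EL.
    rewrite <- (sum_rdot (fun i => c i * weight c i x)).
    rewrite !RtoC_plus, !RtoC_mult, !sqnormE; unfold sum2; simpl.
    rewrite !RtoC_mult, !RtoC_opp; ring.
- replace (sum2 _) with
    (sum2 (fun i => eval (deriv Hol i e) x * co i v +
       eval (deriv Antihol i e) x * Cconj (co i v))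
     + sum2 (fun i => eval (deriv Hol i f) x * co i v +
       eval (deriv Antihol i f) x * Cconj (co i v)))%C by (unfold sum2; ring).
  now apply has_dir_plus.
- replace (sum2 _) with
    (sum2 (fun i => eval (deriv Hol i e) x * co i v +
       eval (deriv Antihol i e) x * Cconj (co i v)) * eval f x
     + eval e x * sum2 (fun i => eval (deriv Hol i f) x * co i v +
       eval (deriv Antihol i f) x * Cconj (co i v)))%C by (unfold sum2; ring).
  now apply has_dir_mult.
Qed.

Lemma weight_continuous i (x : C2) :
  x <> zero2 -> continuous (weight c i : C * C -> R) x.
Proof.
intros Hx; apply cont_exp, cont_mult; [apply continuous_const|].
now apply level_continuous.
Qed.

Lemma eval_continuous e (x : C2) :
  x <> zero2 -> continuous (eval e : C * C -> C) x.
Proof.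
intros Hx; apply cont_complex.
assert (K : forall f : C2 -> R, continuous (f : C * C -> R) x ->
  continuous (fun y : C * C => Re (RtoC (f y))) x /\
  continuous (fun y : C * C => Im (RtoC (f y))) x).
{ intros f Hf; split; [exact Hf | apply continuous_const]. }
induction e as [z|i|i|i| |e [H1 H2] f [H3 H4]|e [H1 H2] f [H3 H4]].
- split; apply continuous_const.
- apply cont_complex, co_continuous.
- destruct (proj1 (cont_complex (co i : C * C -> C) x) (@co_continuous i x))
    as [H1 H2].
  split; [exact H1 | now apply cont_opp].
- now apply K, weight_continuous.
- apply cont_complex.
  apply continuous_ext_loc with (fun y : C * C => RtoC (/ speed c y)).
  { generalize (open_nonzero Hx); apply filter_imp; intros y Hy.
    apply RtoC_inv; generalize (speed_pos c_pos Hy); lra. }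
  apply cont_complex, K, cont_inv; [|generalize (speed_pos c_pos Hx); lra].
  apply cont_plus; repeat apply cont_mult; try apply continuous_const;
    try apply sqnorm_continuous; now apply weight_continuous.
- split; now apply cont_plus.
- split; [apply cont_minus | apply cont_plus]; now apply cont_mult.
Qed.

Section Domain.

Variable D : C2 -> Prop.
Hypothesis D_open : open (D : C * C -> Prop).
Hypothesis D_nonzero : forall x, D x -> x <> zero2.

Lemma dz_eval e i x : D x -> dz i (eval e) x = eval (deriv Hol i e) x.
Proof.
intros Hx; apply (dz_wirtinger i (eval_wirtinger e (D_nonzero Hx))).
Qed.

Lemma dzb_eval e i x : D x -> dzb i (eval e) x = eval (deriv Antihol i e) x.
Proof.
intros Hx; apply (dzb_wirtinger i (eval_wirtinger e (D_nonzero Hx))).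
Qed.

Lemma dz_of_eval f e i x : (forall y, D y -> f y = eval e y) -> D x ->
  dz i f x = eval (deriv Hol i e) x.
Proof.
intros E Hx; rewrite <- (dz_eval _ _ Hx); apply dz_ext with D; auto.
Qed.

(** Partial derivatives are combinations of formal derivatives, hence again values
    of expressions, and the induction on the order closes. *)
Lemma eval_smooth e : smooth_on D (eval e).
Proof.
intros n; revert e; induction n as [|n IH]; intros e.
{ split; [intros x Hx; now apply eval_continuous, D_nonzero | exact I]. }
split; [intros x Hx; now apply eval_continuous, D_nonzero|].
intros i; split; [|split].
- intros x Hx; assert (W := eval_wirtinger e (D_nonzero Hx)).
  split; eapply has_dir_ex, W.
- apply Ck_ext with (eval (Add (deriv Hol i e) (deriv Antihol i e)));
    [exact D_open | | apply IH].
  intros x Hx; rewrite (has_dirE (eval_wirtinger e (D_nonzero Hx) (basis i))).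
  unfold sum2; destruct i; simpl;
    apply injective_projections; simpl; ring.
- apply Ck_ext with (eval (Mul (Cst Ci) (Add (deriv Hol i e)
    (Mul (Cst (- RtoC 1)%C) (deriv Antihol i e)))));
    [exact D_open | | apply IH].
  intros x Hx; rewrite (has_dirE (eval_wirtinger e (D_nonzero Hx) (ibasis i))).
  unfold sum2; destruct i; simpl;
    apply injective_projections; simpl; ring.
Qed.

(** * Curvature of the metric on C^2 minus the origin *)

Definition other (i : idx) : idx := match i with i1 => i2 | i2 => i1 end.

(** The constant factor of each weight is the square of the rate of the other
    coordinate; this choice is what makes the metric Gauduchon. *)
Definition metric (k l : idx) : expr :=
  match k, l with
  | i1, i1 | i2, i2 =>
      Mul (Cst (RtoC (c (other k) * c (other k)))) (Weight k)
  | _, _ => Cst (RtoC 0)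
  end.

Definition metric_fun (k l : idx) : C2 -> C := eval (metric k l).

Lemma metric_hermitian k l x : metric_fun l k x = Cconj (metric_fun k l x).
Proof.
unfold metric_fun; destruct k, l; simpl; apply injective_projections; simpl; ring.
Qed.

Lemma metric_positive (x v : C2) : v <> zero2 ->
  0 < Re (sum2 (fun k => sum2 (fun l =>
            (metric_fun k l x * co k v * Cconj (co l v))%C))).
Proof.
intros Hv.
assert (P : forall k, 0 < c (other k) * c (other k) * weight c k x).
{ intros k; repeat apply Rmult_lt_0_compat; try apply c_pos; apply exp_pos. }
replace (sum2 _) with (RtoC (c i2 * c i2 * weight c i1 x * sqnorm i1 v +
  c i1 * c i1 * weight c i2 x * sqnorm i2 v)).
- rewrite re_RtoC; exact (sqnorm_combination_pos Hv (P i1) (P i2)).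
- rewrite RtoC_plus, !RtoC_mult, !sqnormE; unfold sum2, metric_fun; simpl.
  rewrite !RtoC_mult; ring.
Qed.

(** The coefficients of the (1,0)-form whose squared modulus is, up to a positive
    factor, the complex Hessian of [level c]. *)
Definition conormal (i : idx) (x : C2) : C :=
  match i with
  | i1 => (RtoC (c i2) * co i2 x)%C
  | i2 => (- RtoC (c i1) * co i1 x)%C
  end.

Definition levi_factor (x : C2) : R :=
  weight c i1 x * weight c i2 x / speed c x ^ 3.

Lemma speed_coord x : RtoC (speed c x) =
  (RtoC (c i1) * (co i1 x * Cconj (co i1 x)) * RtoC (weight c i1 x) +
   RtoC (c i2) * (co i2 x * Cconj (co i2 x)) * RtoC (weight c i2 x))%C.
Proof. unfold speed; now rewrite RtoC_plus, !RtoC_mult, !sqnormE. Qed.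

(** The complex Hessian of [level c] is positive semidefinite of rank one.  Both
    sides become equal as rational functions once the right-hand side is
    multiplied by the sum of [sqnorm i x * weight c i x], which is 1 by
    [weight_sum] and makes the numerators homogeneous of equal degree. *)
Lemma levi_form i j x : x <> zero2 ->
  eval (deriv Hol i (level_deriv Antihol j)) x =
  (RtoC (levi_factor x) * conormal i x * Cconj (conormal j x))%C.
Proof.
intros Hx; assert (S := speed_neq0 Hx).
assert (S' := speed_pos c_pos Hx).
assert (H : (RtoC (sqnorm i1 x) * RtoC (weight c i1 x) +
  RtoC (sqnorm i2 x) * RtoC (weight c i2 x) = 1)%C).
{ rewrite <- !RtoC_mult, <- RtoC_plus; f_equal; now apply weight_sum. }
rewrite !sqnormE in H.
assert (E : RtoC (levi_factor x) =
  (RtoC (weight c i1 x) * RtoC (weight c i2 x) / RtoC (speed c x) ^ 3 *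
   (co i1 x * Cconj (co i1 x) * RtoC (weight c i1 x) +
    co i2 x * Cconj (co i2 x) * RtoC (weight c i2 x)))%C).
{ rewrite H; unfold levi_factor, Rdiv.
  rewrite !RtoC_mult, RtoC_inv, RtoC_pow by (apply pow_nonzero; lra).
  unfold Cdiv; ring. }
rewrite E; clear E H.
assert (K : forall r z, Cconj (RtoC r * z) = (RtoC r * Cconj z)%C).
{ intros r [u v]; apply injective_projections; simpl; ring. }
assert (P := speed_coord x).
destruct i, j; simpl; rewrite ?K, <- ?RtoC_opp, ?K, ?RtoC_mult, ?RtoC_opp;
  rewrite P in *; simpl co in *; field; exact S.
Qed.

Lemma RtoC_pos_neq0 r : 0 < r -> RtoC r <> RtoC 0.
Proof. intros Hr E; apply RtoC_inj in E; lra. Qed.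

(** For a diagonal metric the quadratic term of the curvature completes the Hessian
    of [- ln g_k]; here [ln g_k] is [- c k * level c] up to a constant. *)
Lemma metric_curvature i j k l x : D x ->
  chern_curvature metric_fun i j k l x =
  (RtoC (c k) * metric_fun k l x *
   (RtoC (levi_factor x) * conormal i x * Cconj (conormal j x)))%C.
Proof.
intros Hx; rewrite <- (levi_form i j (D_nonzero Hx)).
assert (W : forall m, RtoC (weight c m x) <> RtoC 0)
  by (intros m; apply RtoC_pos_neq0, exp_pos).
assert (L : forall m, RtoC (c m * c m) <> RtoC 0)
  by (intros m; apply RtoC_pos_neq0, Rmult_lt_0_compat; apply c_pos).
assert (W1 := W i1); assert (W2 := W i2).
assert (L1 := L i1); assert (L2 := L i2).
assert (dd : forall k l, dz i (dzb j (metric_fun k l)) x =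
  eval (deriv Hol i (deriv Antihol j (metric k l))) x).
{ intros k' l'; apply dz_of_eval; [|exact Hx].
  intros y Hy; now apply dzb_eval. }
unfold chern_curvature; rewrite dd; unfold sum2, ginv, mdet, metric_fun.
rewrite !(dz_eval _ _ Hx), !(dzb_eval _ _ Hx).
destruct k, l; cbn [metric deriv eval other]; rewrite ?RtoC_opp; field;
  repeat split; assumption.
Qed.

Lemma metric_bisectional x xi eta : D x ->
  bisectional metric_fun x xi eta =
  RtoC ((c i1 * (c i2 * c i2 * weight c i1 x) * sqnorm i1 eta +
         c i2 * (c i1 * c i1 * weight c i2 x) * sqnorm i2 eta) * levi_factor x *
        Cmod (conormal i1 x * co i1 xi + conormal i2 x * co i2 xi) ^ 2).
Proof.
intros Hx; unfold bisectional, sum2; rewrite !(metric_curvature _ _ _ _ Hx).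
set (n1 := conormal i1 x); set (n2 := conormal i2 x).
rewrite !RtoC_mult, !RtoC_plus, Cmod2_conj, !RtoC_mult, !sqnormE.
rewrite Cplus_conj, !Cmult_conj; unfold metric_fun; simpl; rewrite !RtoC_mult.
ring.
Qed.

Lemma metric_semipositive x xi eta : D x ->
  Im (bisectional metric_fun x xi eta) = 0 /\
  0 <= Re (bisectional metric_fun x xi eta).
Proof.
intros Hx; rewrite (metric_bisectional xi eta Hx), im_RtoC, re_RtoC.
split; [reflexivity|].
assert (S := speed_pos c_pos (D_nonzero Hx)).
assert (T : forall k l m, 0 <= c k * (c l * c l * weight c k x) * sqnorm k m).
{ intros k l m; apply Rmult_le_pos; [apply Rlt_le | apply sqnorm_ge0].
  repeat apply Rmult_lt_0_compat; try apply c_pos; apply exp_pos. }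
apply Rmult_le_pos; [apply Rmult_le_pos|apply pow2_ge_0].
- apply Rplus_le_le_0_compat; apply T.
- apply Rlt_le, Rdiv_lt_0_compat; [|now apply pow_lt].
  apply Rmult_lt_0_compat; apply exp_pos.
Qed.

(** Each summand is a multiple of
    [c i2 * q ^ 2 - c i1 * p ^ 2], where [p] and [q] are the two terms of
    [weight_sum]; the constants in [metric] make the multiples opposite. *)
Lemma metric_balance x : x <> zero2 ->
  (eval (deriv Hol i2 (deriv Antihol i2 (metric i1 i1))) x +
   eval (deriv Hol i1 (deriv Antihol i1 (metric i2 i2))) x)%C = RtoC 0.
Proof.
intros Hx; assert (S := speed_neq0 Hx); assert (P := speed_coord x).
rewrite P in S; unfold level_deriv; cbn in *; rewrite ?RtoC_mult, ?RtoC_opp.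
rewrite P; field; exact S.
Qed.

Lemma metric_offdiag h h' i j k x :
  eval (deriv h i (deriv h' j (metric k (other k)))) x = RtoC 0.
Proof. now destruct k. Qed.

(** A diagonal form leaves only the component with [i <> k] and [j <> l], which is
    up to sign the sum in [metric_balance]. *)
Lemma metric_del12 i k j l x : D x ->
  del12 (dbar11 (fun k l y => Ci * metric_fun k l y)%C) i k j l x = RtoC 0.
Proof.
intros Hx.
assert (E : forall k' j' l' y, D y ->
  dbar11 (fun k l y => Ci * metric_fun k l y)%C k' j' l' y =
  eval (Mul (Cst Ci) (Add (deriv Antihol j' (metric k' l'))
    (Mul (Cst (- RtoC 1)%C) (deriv Antihol l' (metric k' j'))))) y).
{ intros k' j' l' y Hy; unfold dbar11.
  change (fun y => (Ci * metric_fun k' l' y)%C) with (eval (Mul (Cst Ci) (metric k' l'))).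
  change (fun y => (Ci * metric_fun k' j' y)%C) with (eval (Mul (Cst Ci) (metric k' j'))).
  rewrite !(dzb_eval _ _ Hy); cbn [deriv eval]; ring. }
unfold del12.
rewrite (dz_of_eval _ (E k j l) Hx), (dz_of_eval _ (E i j l) Hx).
assert (B := metric_balance (D_nonzero Hx)).
set (u := eval (deriv Hol i2 (deriv Antihol i2 (metric i1 i1))) x) in B.
set (v := eval (deriv Hol i1 (deriv Antihol i1 (metric i2 i2))) x) in B.
assert (V : v = (- u)%C).
{ replace v with (u + v - u)%C by ring; rewrite B; ring. }
assert (Z := fun h h' i j => metric_offdiag h h' i j i1 x).
assert (Z' := fun h h' i j => metric_offdiag h h' i j i2 x).
cbn [other] in Z, Z'.
destruct i, k, j, l; cbn [deriv eval]; rewrite ?Z, ?Z'; fold u v;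
  rewrite ?V; ring.
Qed.

End Domain.

End Expressions.

(** * The Hopf surface *)

Section Hopf.

Variables a b : C.
Hypothesis Ha : 1 < Cmod a.
Hypothesis Hb : 1 < Cmod b.

Definition multiplier (i : idx) : C := match i with i1 => a | i2 => b end.

Definition hopf_rate (i : idx) : R := 2 * ln (Cmod (multiplier i)).

Lemma multiplier_gt1 i : 1 < Cmod (multiplier i).
Proof. now destruct i. Qed.

Lemma hopf_rate_pos i : 0 < hopf_rate i.
Proof.
unfold hopf_rate; generalize (ln_increasing 1 _ Rlt_0_1 (multiplier_gt1 i)).
rewrite ln_1; lra.
Qed.

Lemma co_act i k x : co i (act a b k x) = (Cpowz (multiplier i) k * co i x)%C.
Proof. now destruct i. Qed.

Lemma Cmod_multiplier i k :
  Cmod (Cpowz (multiplier i) k) ^ 2 = exp (hopf_rate i * IZR k).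
Proof.
rewrite Cmod_Cpowz by apply multiplier_gt1; unfold Rpower, hopf_rate; simpl.
rewrite Rmult_1_r, <- exp_plus; f_equal; ring.
Qed.

Lemma sqnorm_act i k x :
  sqnorm i (act a b k x) = exp (hopf_rate i * IZR k) * sqnorm i x.
Proof.
rewrite !sqnorm_Cmod, co_act, Cmod_mult, Rpow_mult_distr.
now rewrite Cmod_multiplier.
Qed.

Lemma act_neq0 k x : x <> zero2 -> act a b k x <> zero2.
Proof.
intros Hx E; symmetry in E; apply (act_opp Ha Hb) in E.
now rewrite act_zero2 in E.
Qed.

(** The step multiplies [sqnorm i] by [exp (hopf_rate i)], which a unit shift of
    the level compensates. *)
Lemma level_act k x : x <> zero2 ->
  level hopf_rate (act a b k x) = level hopf_rate x + IZR k.
Proof.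
intros Hx; apply (level_eq hopf_rate_pos); [now apply act_neq0|].
rewrite <- (gauge_level hopf_rate_pos Hx); unfold gauge; rewrite !sqnorm_act.
rewrite !Rmult_plus_distr_l, !exp_plus.
assert (K : forall i, exp (hopf_rate i * IZR k) * exp (- hopf_rate i * IZR k) = 1).
{ intros i; rewrite <- exp_plus, <- exp_0; f_equal; ring. }
assert (K1 := K i1); assert (K2 := K i2).
rewrite <- (Rmult_1_l (sqnorm i1 x * _)), <- (Rmult_1_l (sqnorm i2 x * _)).
rewrite <- K1 at 1; rewrite <- K2 at 1; ring.
Qed.

(** This is the invariance of [weight i |dz^i|^2] under the group. *)
Lemma weight_act i k x : x <> zero2 ->
  RtoC (weight hopf_rate i x) =
  (Cpowz (multiplier i) k * Cconj (Cpowz (multiplier i) k) *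
   RtoC (weight hopf_rate i (act a b k x)))%C.
Proof.
intros Hx; rewrite <- Cmod2_conj, Cmod_multiplier, <- RtoC_mult; f_equal.
unfold weight; rewrite level_act, <- exp_plus by exact Hx; f_equal; ring.
Qed.

Lemma ch_image_nonzero (ch : chart (hopf_pt a b)) x :
  hopf_atlas ch -> ch_image ch x -> x <> zero2.
Proof.
intros [_ Hc] [p [Hp <-]]; apply (in_class_nonzero Ha Hb (p := p)), Hc, Hp.
Qed.

Lemma dz_transition (ch d : chart (hopf_pt a b)) k x m n : x <> zero2 ->
  locally (x : C * C) (fun y => transition ch d y = act a b k y) ->
  dz n (fun y => co m (transition ch d y)) x =
  (Cpowz (multiplier m) k * kron n m)%C.
Proof.
intros Hx Hk.
rewrite (dz_ext (g := eval hopf_rate (Mul (Cst (Cpowz (multiplier m) k)) (Coord m)))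
  n Hk).
2: { intros y ->; apply co_act. }
rewrite (dz_wirtinger n (eval_wirtinger hopf_rate_pos _ Hx)); simpl; ring.
Qed.

Lemma hopf_metric_smooth (ch : chart (hopf_surface Ha Hb)) k l :
  cs_atlas ch -> smooth_on (ch_image ch) (metric_fun hopf_rate k l).
Proof.
intros Hc; apply (eval_smooth hopf_rate_pos); [apply Hc|].
intros x; now apply ch_image_nonzero.
Qed.

Lemma hopf_metric_tensor (ch d : chart (hopf_surface Ha Hb)) p k l :
  cs_atlas ch -> cs_atlas d -> ch_dom ch p -> ch_dom d p ->
  let x := ch_coord ch p in
  let J m n := dz n (fun y => co m (transition ch d y)) x in
  metric_fun hopf_rate k l x =
    sum2 (fun m => sum2 (fun n =>
      (J m k * Cconj (J n l) * metric_fun hopf_rate m n (transition ch d x))%C)).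
Proof.
intros Hc Hd Hcp Hdp x J.
destruct (hopf_transition Ha Hb Hc Hd Hcp Hdp) as [s Hs].
assert (Hx : x <> zero2).
{ apply (ch_image_nonzero (ch := ch)); [exact Hc | now exists p]. }
assert (EJ : forall m n, J m n = (Cpowz (multiplier m) s * kron n m)%C).
{ intros m n; now apply dz_transition. }
assert (T : transition ch d x = act a b s x) by exact (locally_singleton _ _ Hs).
rewrite T; unfold sum2; rewrite !EJ, !Cmult_conj.
unfold metric_fun; fold x.
assert (W1 := weight_act i1 s Hx); assert (W2 := weight_act i2 s Hx).
assert (K0 : Cconj (RtoC 0) = RtoC 0) by (apply injective_projections; simpl; ring).
assert (K1 : Cconj (RtoC 1) = RtoC 1) by (apply injective_projections; simpl; ring).
destruct k, l; simpl metric; simpl eval; simpl kron; rewrite ?W1, ?W2, ?K0, ?K1; ring.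
Qed.

Definition hopf_metric : hermitian_metric (hopf_surface Ha Hb) :=
  @HermitianMetric (hopf_surface Ha Hb) (fun _ => metric_fun hopf_rate)
    hopf_metric_smooth
    (fun _ k l x _ _ => metric_hermitian hopf_rate k l x)
    (fun _ x v _ _ => metric_positive hopf_rate_pos x (v := v))
    hopf_metric_tensor.

Lemma hopf_metric_gauduchon : gauduchon hopf_metric.
Proof.
intros ch x Hc Hx i k j l.
apply (metric_del12 hopf_rate_pos (D := ch_image ch)); [apply Hc | | exact Hx].
intros y; now apply ch_image_nonzero.
Qed.

Lemma hopf_metric_semipositive : semipositive_bisectional hopf_metric.
Proof.
intros ch x xi eta Hc Hx _ _.
change (hopf_metric ch) with (metric_fun hopf_rate).
assert (N : forall y, ch_image ch y -> y <> zero2).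
{ intros y; now apply ch_image_nonzero. }
exact (metric_semipositive hopf_rate_pos (proj1 Hc) N xi eta Hx).
Qed.

End Hopf.

Unset Implicit Arguments.

Theorem proposition1p10 (a b : C) (hab : Cmod b <= Cmod a) (hb : 1 < Cmod b) :
  exists g : hermitian_metric
      (@hopf_surface a b (Rlt_le_trans 1 (Cmod b) (Cmod a) hb hab) hb),
    gauduchon g /\ semipositive_bisectional g.
Proof.
exists (hopf_metric (Rlt_le_trans 1 (Cmod b) (Cmod a) hb hab) hb); split.
- apply hopf_metric_gauduchon.
- apply hopf_metric_semipositive.
Qed.
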